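(* Let $n\in\{2,3\}$. Suppose there exist $T_*>0$ and $\alpha\in\mathbb{R}$, $\alpha\neq -1$, and a classical solution $(v,b)$ of the ideal magnetohydrodynamic equations (MHD) in $\mathbb{R}^n$ which is represented for all $t\in(0,T_* )$ and $x\in\mathbb{R}^n$ by $$v(x,t)=\frac{1}{(T_*-t)^{\frac{\alpha}{\alpha+1}}}V\left(\frac{x}{(T_*-t)^{\frac{1}{\alpha+1}}}\right),\qquad b(x,t)=\frac{1}{(T_*-t)^{\frac{\alpha}{\alpha+1}}}B\left(\frac{x}{(T_*-t)^{\frac{1}{\alpha+1}}}\right),$$ where $(V,B)$ satisfies the following conditions: (i) $(V,B)\in [C_0^1(\mathbb{R}^n)]^2$; (ii) there exists $q_1>0$ such that $(\Omega,B)\in [L^q(\mathbb{R}^n)]^2$ for all $q\in(0,q_1)$, where $\Omega=\operatorname{curl}V$. Then $V=B=0$.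
   Context: The ideal magnetohydrodynamic equations (MHD) in $\mathbb{R}^n$, $n=2,3$, are $$\partial_t v+(v\cdot\nabla)v=(b\cdot\nabla)b-\nabla\left(p+\tfrac12|b|^2\right),\quad \partial_t b+(v\cdot\nabla)b=(b\cdot\nabla)v,\quad \operatorname{div}v=\operatorname{div}b=0,$$ with initial data $v(x,0)=v_0(x)$, $b(x,0)=b_0(x)$ satisfying $\operatorname{div}v_0=\operatorname{div}b_0=0$. Here $v=v(x,t)\in\mathbb{R}^n$ is the velocity, $b=b(x,t)\in\mathbb{R}^n$ the magnetic field, and $p=p(x,t)$ the scalar pressure. $(v,b)$ is a solution if the equations hold together with some scalar pressure $p$. For $n=2$, $\operatorname{curl}V=\partial_1V_2-\partial_2V_1$. $C_0^m(\mathbb{R}^n)$ denotes the collection of $C^m(\mathbb{R}^n)$ functions (here vector valued) all of whose derivatives up to order $m$ (including order $0$) vanish at infinity. For $0<q<\infty$, $f\in L^q(\mathbb{R}^n)$ means $f$ is measurable with $\int_{\mathbb{R}^n}|f|^q\,dx<\infty$. *)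

(* Defs.v *)
From HB Require Import structures.
From mathcomp Require Import all_boot all_order all_algebra.
From mathcomp Require Import all_classical all_reals all_analysis.

Set Implicit Arguments.
Unset Strict Implicit.
Unset Printing Implicit Defensive.

Import Order.TTheory GRing.Theory Num.Theory.
Import numFieldNormedType.Exports.

Local Open Scope classical_set_scope.
Local Open Scope ring_scope.

(* The library has no Lebesgue measure on R^n: it is built here on n.-tuple R,
   with its product sigma-algebra (the Borel sets of R^n), as the n-fold product
   of the Lebesgue measure of R, pushed forward at each step along
   (x, t) |-> x :: t. *)
Section lebesgue_tuple_step.
Context {R : realType} {n : nat}.
Variable mu : {sigma_finite_measure set (n.-tuple R) -> \bar R}.

Definition tuple_consp (z : R * n.-tuple R) : n.+1.-tuple R :=
  [tuple of z.1 :: z.2].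

Lemma measurable_tuple_consp : measurable_fun setT tuple_consp.
Proof. exact: measurable_cons. Qed.

Definition lebesgue_tuple_step : set (n.+1.-tuple R) -> \bar R :=
  pushforward (@lebesgue_measure R \x mu)%E tuple_consp.

Let step0 : lebesgue_tuple_step set0 = 0%E.
Proof. by rewrite /lebesgue_tuple_step /pushforward preimage_set0 measure0. Qed.

Let step_ge0 A : (0 <= lebesgue_tuple_step A)%E.
Proof. by rewrite /lebesgue_tuple_step /pushforward measure_ge0. Qed.

Let step_sigma_additive : semi_sigma_additive lebesgue_tuple_step.
Proof.
move=> F mF tF mUF; rewrite /lebesgue_tuple_step /pushforward preimage_bigcup.
have mp A : measurable A -> measurable (tuple_consp @^-1` A).
  by move=> mA; rewrite -[X in measurable X]setTI; exact: measurable_tuple_consp.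
apply: measure_semi_sigma_additive.
- by move=> i; exact: mp.
- apply/trivIsetP => /= i j _ _ ij; rewrite -preimage_setI.
  by move/trivIsetP : tF => /(_ _ _ _ _ ij) ->//; rewrite preimage_set0.
- by rewrite -preimage_bigcup; exact: mp.
Qed.

HB.instance Definition _ := isMeasure.Build _ _ _ lebesgue_tuple_step
  step0 step_ge0 step_sigma_additive.

Let step_sigma_finite : sigma_finite setT lebesgue_tuple_step.
Proof.
have /sigma_finiteP[F [TF ndF Foo]] := sigma_finiteT (@lebesgue_measure R).
have /sigma_finiteP[G [TG ndG Goo]] := sigma_finiteT mu.
pose g (t : n.+1.-tuple R) : R * n.-tuple R := (thead t, [tuple of behead t]).
have mg : measurable_fun setT g.
  by apply: measurable_fun_pair; [exact: measurable_tnth|exact: measurable_behead].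
have gK z : g (tuple_consp z) = z.
  by case: z => x t; congr (_, _); apply: val_inj.
exists (fun k => g @^-1` (F k `*` G k)).
  rewrite -preimage_bigcup -[LHS](preimage_setT g); congr (_ @^-1` _).
  rewrite -setXTT TF TG predeqE => -[x y]; split.
    move=> [/= [i _ Fix] [k _ Gky]]; exists (maxn i k) => //; split.
    - by move: x Fix; exact/subsetPset/ndF/leq_maxl.
    - by move: y Gky; exact/subsetPset/ndG/leq_maxr.
  by move=> [i _ []/= ? ?]; split; exists i.
move=> k; have [mF Fkoo] := Foo k; have [mG Gkoo] := Goo k; split.
  by rewrite -[X in measurable X]setTI; apply: mg => //; exact: measurableX.
rewrite /lebesgue_tuple_step /pushforward -comp_preimage.
rewrite (_ : g \o tuple_consp = id); last by apply/funext => z /=.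
by rewrite preimage_id product_measure1E// lte_mul_pinfty// ge0_fin_numE.
Qed.

HB.instance Definition _ := Measure_isSigmaFinite.Build _ _ _ lebesgue_tuple_step
  step_sigma_finite.

End lebesgue_tuple_step.

Fixpoint lebesgue_tuple {R : realType} n :
    {sigma_finite_measure set (n.-tuple R) -> \bar R} :=
  match n with
  | 0 => @dirac _ _ ([tuple] : 0.-tuple R) R
  | m.+1 => lebesgue_tuple_step (lebesgue_tuple m)
  end.

Lemma lebesgue_tuple_box (R : realType) n (A : 'I_n -> set R) :
  (forall i, measurable (A i)) ->
  lebesgue_tuple n [set t | forall i, A i (tnth t i)] =
  (\prod_(i < n) lebesgue_measure (A i))%E.
Proof.
elim: n A => [|n IHn] A mA.
  by rewrite big_ord0 /= diracE mem_set// => -[].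
pose A' (i : 'I_n) := A (lift ord0 i).
rewrite big_ord_recl -(IHn A'); last by move=> i; exact: mA.
rewrite//= /lebesgue_tuple_step /pushforward.
have mA' : measurable [set t : n.-tuple R | forall i, A' i (tnth t i)].
  have -> : [set t : n.-tuple R | forall i, A' i (tnth t i)] =
      \big[setI/setT]_(i < n) ((fun t => tnth t i) @^-1` A' i).
    apply/seteqP; split => t /=; rewrite -bigcap_seq.
      by move=> tA i _; exact: tA.
    by move=> tA i; apply: tA; rewrite /= mem_index_enum.
  apply: bigsetI_measurable => i _; rewrite -[X in measurable X]setTI.
  by apply: (@measurable_tnth _ _ n i) => //; exact: mA.
rewrite -product_measure1E; [|exact: mA|exact: mA'].
congr (product_measure1 _ _ _).
apply/seteqP; split => -[x t] /=.
  move=> h; split; first exact: (h ord0).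
  by move=> i; have := h (lift ord0 i); rewrite tnthS.
move=> [x0 h] i; case: (unliftP ord0 i) => [j ->|->]; last exact: x0.
by rewrite tnthS; exact: h.
Qed.

Section fields.
Context {R : realType}.

Definition enorm k (u : 'rV[R]_k) : R := Num.sqrt (\sum_(i < k) u 0 i ^+ 2).

Definition Lebesgue_class n k (q : R) (f : 'rV[R]_n -> 'rV[R]_k) : Prop :=
  let g (t : n.-tuple R) := f (\row_i tnth t i) in
  (forall i, measurable_fun setT (fun t => g t 0 i)) /\
  (\int[lebesgue_tuple n]_t (enorm (g t) `^ q)%:E < +oo)%E.

(* For finite-dimensional E, continuity of all the directional derivatives is
   continuity of the differential. *)
Definition C1_on (E W : normedModType R) (U : set E) (f : E -> W) : Prop :=
  forall z, U z -> differentiable f z /\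
    forall h : E, {for z, continuous ('D_h f)}.

Definition vanishes_at_infinity (E W : normedModType R) (f : E -> W) : Prop :=
  forall e : R, 0 < e -> exists M : R, forall x, M < `|x| -> `|f x| < e.

Definition C1_0 (E W : normedModType R) (f : E -> W) : Prop :=
  [/\ C1_on setT f, vanishes_at_infinity f &
      forall h : E, vanishes_at_infinity ('D_h f)].

Definition partial n (W : normedModType R) (j : 'I_n) (f : 'rV[R]_n -> W) :
    'rV[R]_n -> W :=
  'D_(delta_mx 0 j) f.

Definition gradient n (f : 'rV[R]_n -> R) (x : 'rV[R]_n) : 'rV[R]_n :=
  \row_j partial j f x.

Definition divergence n (u : 'rV[R]_n -> 'rV[R]_n) (x : 'rV[R]_n) : R :=
  \sum_(j < n) partial j (fun y => u y 0 j) x.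

(* (u . nabla) w *)
Definition advection n (u w : 'rV[R]_n -> 'rV[R]_n) (x : 'rV[R]_n) : 'rV[R]_n :=
  \sum_(j < n) u x 0 j *: partial j w x.

Definition curl2 (u : 'rV[R]_2 -> 'rV[R]_2) (x : 'rV[R]_2) : R :=
  partial 0 (fun y => u y 0 1) x - partial 1 (fun y => u y 0 0) x.

Definition curl3 (u : 'rV[R]_3 -> 'rV[R]_3) (x : 'rV[R]_3) : 'rV[R]_3 :=
  let d (j i : 'I_3) := partial j (fun y => u y 0 i) x in
  \row_(k < 3) [tuple d 1 2 - d 2 1; d 2 0 - d 0 2; d 0 1 - d 1 0]`_k.

(* The curl is scalar (a row of length 1) for n = 2 and a vector for n = 3;
   the other dimensions are junk values. *)
Definition curl_dim n : nat := if n is 3 then 3 else 1.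

Definition curl n :
    ('rV[R]_n -> 'rV[R]_n) -> 'rV[R]_n -> 'rV[R]_(curl_dim n) :=
  match n with
  | 2 => fun u x => const_mx (curl2 u x)
  | 3 => curl3
  | _ => fun _ _ => 0
  end.

(* v, b, p take the space variable first, then time. *)
Definition ideal_MHD_equations n (v b : 'rV[R]_n -> R -> 'rV[R]_n)
    (p : 'rV[R]_n -> R -> R) (x : 'rV[R]_n) (t : R) : Prop :=
  [/\ derive1 (v x) t + advection (v^~ t) (v^~ t) x =
        advection (b^~ t) (b^~ t) x -
        gradient (fun y => p y t + 2^-1 * enorm (b y t) ^+ 2) x,
      derive1 (b x) t + advection (v^~ t) (b^~ t) x =
        advection (b^~ t) (v^~ t) x,
      divergence (v^~ t) x = 0 &
      divergence (b^~ t) x = 0].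

Definition initial_datum n (u0 : 'rV[R]_n -> 'rV[R]_n) : Prop :=
  C1_on setT u0 /\ forall x, divergence u0 x = 0.

Definition classical_field n (T : R) (u0 : 'rV[R]_n -> 'rV[R]_n)
    (u : 'rV[R]_n -> R -> 'rV[R]_n) : Prop :=
  let U (z : 'rV[R]_n * R) := u z.1 z.2 in
  [/\ C1_on [set z | 0 < z.2 < T] U,
      {within [set z | 0 <= z.2 < T], continuous U} &
      forall x, u x 0 = u0 x].

(* Classical solution on R^n x (0, T), continuous up to t = 0, where it takes
   the initial data. *)
Definition classical_MHD_solution n (T : R) (v0 b0 : 'rV[R]_n -> 'rV[R]_n)
    (v b : 'rV[R]_n -> R -> 'rV[R]_n) : Prop :=
  [/\ initial_datum v0, initial_datum b0,
      classical_field T v0 v, classical_field T b0 b &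
      exists p : 'rV[R]_n -> R -> R, forall t, 0 < t < T ->
        C1_on setT (p^~ t) /\ forall x, ideal_MHD_equations v b p x t].

Definition self_similar n (T alpha : R) (u : 'rV[R]_n -> R -> 'rV[R]_n)
    (U : 'rV[R]_n -> 'rV[R]_n) : Prop :=
  forall x t, 0 < t < T ->
    u x t = ((T - t) `^ (alpha / (alpha + 1)))^-1 *:
            U (((T - t) `^ (1 / (alpha + 1)))^-1 *: x).

End fields.

(* Main.v *)
(** Let b = 1/(alpha+1) and w = V + b x, so that div w = n b <> 0. Inserting the
    self-similar ansatz at one fixed time gives the profile equations
    w.grad B = B.grad V - alpha b B and, once B = 0,
    alpha b V + w.grad V = - grad P.

    Liouville principle: let s >= 0 satisfy |w.grad s| <= K s, with s^p integrable
    for all small p > 0. Integrating the divergence of chi s^p w, where chi is a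
    cutoff at radius m, and letting m go to infinity gives
    |div w| int s^p <= K p int s^p, because |w.grad chi| stays bounded (w grows
    linearly) and tends to 0 pointwise. For p < |div w| / K this forces s = 0.
    With s = |B|^2 it yields B = 0.

    The vorticity A_ij = d_i V_j - d_j V_i is only continuous, so its transport
    equation is used for the averages F_ij(y) over small squares, that is, the
    circulations of V along their boundaries. By Cartan's formula the momentum
    equation says that (alpha - 1) b V + i_w A is a gradient, hence has no
    circulation; comparing with the exact identity d_k F_ij = circulation of
    the 1-form A_k1, ..., A_kn shows that w.grad F is, up to a uniformly small error, linear in A. The
    Liouville principle with s = |A|^2 gives A = 0.

    Finally, V is curl free and divergence free; the increments of its potential
    are harmonic and vanish at infinity, so V is constant, hence 0. *)
Require Import Defs.
From mathcomp Require Import all_boot all_order all_algebra.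
From mathcomp Require Import all_classical all_reals all_analysis.
From mathcomp Require Import measurable_realfun ring lra.
Import Order.TTheory GRing.Theory Num.Theory.
Import numFieldNormedType.Exports.
Local Open Scope classical_set_scope.
Local Open Scope ring_scope.
Set Implicit Arguments.
Unset Strict Implicit.
Unset Printing Implicit Defensive.

(** * Integration by parts on R^n *)

(** The constant K comes from sup norms of the first derivatives of the profiles, which are bounded
    because they are continuous and decay, but not small. The condition p < |div w| / K must
    therefore be met by shrinking p, and integrability for all small exponents is what permits this.

    The magnetic profile comes first because its equation is linear in B with bounded coefficients,
    whereas the momentum equation loses the Lorentz force only once B = 0.

    The obstacle is regularity: s^p fails to be differentiable at zeros of s, and the vorticity A is
    only continuous. The Liouville principle is therefore stated for a continuous s with C^1
    approximants satisfying the inequality up to an error e uniform in space. Such an error is not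
    integrable over R^n, but it only meets compactly supported weights: once the cutoff radius m is
    fixed, e is taken so small that the total error is at most 1/m. Uniformity in space comes from
    the uniform continuity of continuous functions vanishing at infinity. The dimension enters when
    |A|^2 is identified with 2 |curl V|^2. *)

Section row_vectors.
Context {R : realType} {n : nat}.

Lemma ler_coord_norm (x : 'rV[R]_n) i : `|x 0 i| <= `|x|.
Proof.
rewrite [leRHS]/Num.norm/= mx_normrE; apply/bigmax_geP; right => /=.
by exists (0, i).
Qed.

Lemma ler_norm_coord (x : 'rV[R]_n) e :
  0 <= e -> (forall i, `|x 0 i| <= e) -> `|x| <= e.
Proof.
move=> e0 xe; rewrite [leLHS]/Num.norm/= mx_normrE; apply/bigmax_leP; split => //=.
by move=> -[i j] _ /=; rewrite (ord1 i).
Qed.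

Definition row_of_tuple (t : n.-tuple R) : 'rV[R]_n := \row_i tnth t i.

Lemma measurable_box (x : 'rV[R]_n) (e : R) :
  measurable [set t : n.-tuple R | ball x e (row_of_tuple t)].
Proof.
have [e0|e0] := ltP 0 e; last first.
  rewrite [X in measurable X](_ : _ = set0)//; apply/seteqP; split => // t /=.
  by case; rewrite ltNge e0.
rewrite [X in measurable X](_ : _ = \big[setI/setT]_(i < n)
    ((fun t : n.-tuple R => tnth t i : R) @^-1` ball (x 0 i) e)); last first.
  apply/seteqP; split => t /=; rewrite -bigcap_seq.
    by move=> [_ xt] i _ /=; have := xt 0 i; rewrite mxE.
  move=> xt; split => // j i; rewrite (ord1 j) mxE.
  exact: (xt i (mem_index_enum _)).
apply: bigsetI_measurable => i _; rewrite -[X in measurable X]setTI.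
by apply: (@measurable_tnth _ _ n i) => //; exact: measurable_ball.
Qed.

Lemma rat_vector_near (x : 'rV[R]_n) (e : R) : 0 < e ->
  exists q : 'rV[rat]_n, ball (map_mx ratr q : 'rV[R]_n) e x.
Proof.
move=> e0.
have /choice[f fP] : forall i, exists q : rat, ball (ratr q : R) e (x 0 i).
  move=> i; have [|q] := @rat_in_itvoo R (x 0 i - e) (x 0 i + e); first lra.
  rewrite in_itv/= => /andP[q1 q2]; exists q.
  by rewrite /ball/= ltr_norml; lra.
exists (\row_i f i); split => // j i; rewrite (ord1 j) !mxE; exact: fP.
Qed.

(** Measurable sets of tuples are generated by coordinates, open sets come from the norm on row
    vectors. The bridge: an open set is the countable union of the boxes with rational centre and
    radius [1/(k+1)] that it contains. *)
Lemma measurable_open_rV (U : set 'rV[R]_n) : open U ->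
  measurable [set t : n.-tuple R | U (row_of_tuple t)].
Proof.
move=> oU.
pose Q (a : 'rV[rat]_n * nat) : Prop :=
  ball (map_mx ratr a.1 : 'rV[R]_n) a.2.+1%:R^-1 `<=` U.
rewrite [X in measurable X](_ : _ = \bigcup_(a in Q)
    [set t | ball (map_mx ratr a.1 : 'rV[R]_n) a.2.+1%:R^-1 (row_of_tuple t)]).
  rewrite bigcup_mkcond; apply: countable_bigcupT_measurable => [|a]; first exact: countableP.
  case: ifP => // _; exact: measurable_box.
apply/seteqP; split => t /=; last by move=> [a Qa /Qa].
move=> Ut.
(* The radius is doubled because the box has to be recentred at a rational [q] near the point: the
   box of radius [1/(k+1)] around [q] lies in the box of twice that radius around the point. *)
have [k kU] : exists k : nat, ball (row_of_tuple t) (2 * k.+1%:R^-1) `<=` U.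
  have [e /= e0 xU] := open_subball oU Ut.
  exists (Num.truncn (2 / e)); apply: xU => //=.
  rewrite /ball_ /= sub0r normrN ger0_norm ?mulr_ge0// -ltr_pdivlMl//.
  by rewrite invf_plt ?posrE ?mulr_gt0// invfM invrK truncnS_gt.
have k0 : 0 < k.+1%:R^-1 :> R by [].
have [q qt] := rat_vector_near (row_of_tuple t) k0.
exists (q, k) => // y /= qy; apply: kU.
by rewrite mulrDl !mul1r; exact: ball_triangle (ball_sym qt) qy.
Qed.

Lemma measurable_row_of_tuple (f : 'rV[R]_n -> R) : continuous f ->
  measurable_fun [set: n.-tuple R] (f \o row_of_tuple).
Proof.
move=> /continuousP cf; apply: (measurability _ (RGenOInfty.measurableE R)) => //.
move=> _ [_ [a ->] <-]; rewrite setTI.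
exact: (measurable_open_rV (cf _ (rray_open a))).
Qed.

End row_vectors.
Lemma lipschitz_continuous_map (R : realType) (E W : normedModType R) (f : E -> W) (K : R) :
  (forall x y, `|f x - f y| <= K * `|x - y|) -> continuous f.
Proof.
move=> fK x; apply/cvgrPdist_lt => e e0.
have K1 : 0 < `|K| + 1 by rewrite ltr_wpDl.
near=> y; rewrite (le_lt_trans (fK _ _))//.
rewrite (@le_lt_trans _ _ ((`|K| + 1) * `|x - y|))//.
  by rewrite ler_wpM2r// (le_trans (ler_norm K))// lerDl.
rewrite -ltr_pdivlMl//; near: y.
by apply: cvgr_dist_lt => //; rewrite mulr_gt0// invr_gt0.
Unshelve. all: by end_near. Qed.

(** Both difference quotients are the same function of [h]. This transfers one-variable results
    (chain rule, mean value theorem) to directional derivatives. *)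
Lemma is_derive_lineP (R : realType) (E W : normedModType R) (f : E -> W) (a v : E) (d : W) :
  is_derive a v f d <-> is_derive (0 : R) 1 (fun h : R => f (h *: v + a)) d.
Proof.
have eqf : (fun h : R => h^-1 *: (f (h *: v + a) - f a)) =
    (fun h : R => h^-1 *: ((fun h => f (h *: v + a)) (h *: 1 + 0) -
      (fun h => f (h *: v + a)) 0)).
  by apply/funext => h; rewrite addr0 scale0r add0r scaler1.
split=> -[df fd]; apply: DeriveDef.
- by move: df; rewrite /derivable [X in cvg (X @ _)]eqf.
- by rewrite -fd /derive [X in _ = lim (X @ _)]eqf.
- by rewrite /derivable [X in cvg (X @ _)]eqf.
- by rewrite -fd /derive [X in lim (X @ _) = _]eqf.
Qed.

Section compact_support.
Context {R : realType}.

Lemma compact_norm_le n (r : R) : compact [set x : 'rV[R]_n | `|x| <= r].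
Proof.
apply: bounded_closed_compact.
  exists r; split; first exact: num_real.
  by move=> y ry x /= xr; rewrite (le_trans xr)// ltW.
apply: (@closed_comp _ _ (fun x : 'rV[R]_n => `|x|) [set y | y <= r]).
  by move=> x _; exact: norm_continuous.
exact: closed_le.
Qed.

Lemma continuous_bounded_ball n (f : 'rV[R]_n -> R) (M : R) : continuous f ->
  exists K : R, 0 <= K /\ forall x : 'rV[R]_n, `|x| <= M -> `|f x| <= K.
Proof.
move=> cf.
have cB : compact [set x : 'rV[R]_n | `|x| <= M] by exact: compact_norm_le.
have [M0|M0] := ltP M 0.
  by exists 0; split=> // x xM; have := le_lt_trans xM M0; rewrite normr_lt0.
have [||c _ cP] := @EVT_max_rV R n (fun x => `|f x|) _ _ cB.
- by exists 0; rewrite /= normr0.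
- apply: continuous_subspaceT => x.
  exact: cvg_norm (cf x).
exists `|f c|; split => // x xM; apply: cP; exact: mem_set.
Qed.

(** The norm on row vectors is the maximum norm, so the ball carrying [f] is a product of intervals,
    of finite measure by [lebesgue_tuple_box]; on it [f] is bounded. *)
Lemma integrable_compact_support n (f : 'rV[R]_n -> R) (M : R) : continuous f ->
  (forall x, M < `|x| -> f x = 0) ->
  (lebesgue_tuple n).-integrable setT (EFin \o f \o row_of_tuple).
Proof.
move=> cf f0; have [K [K0 fK]] := continuous_bounded_ball M cf.
pose D := [set t : n.-tuple R | forall i, `[- `|M|, `|M|]%classic (tnth t i)].
have mD : measurable D.
  rewrite (_ : D = ~` [set t | [set x : 'rV[R]_n | `|M| < `|x|] (row_of_tuple t)]).
    apply/measurableC; apply: measurable_open_rV.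
    apply: (@open_comp _ _ (fun x : 'rV[R]_n => `|x|) [set y | `|M| < y]).
      by move=> x _; exact: norm_continuous.
    exact: open_gt.
  apply/seteqP; split => t /=.
    move=> Dt; apply/negP; rewrite -leNgt; apply: ler_norm_coord => // i.
    by rewrite mxE ler_norml; exact: Dt.
  move=> /negP; rewrite -leNgt => tM i; rewrite /= in_itv/= -ler_norml.
  by apply: le_trans tM; have := ler_coord_norm (row_of_tuple t) i; rewrite mxE.
have Doo : (lebesgue_tuple n D < +oo)%E.
  rewrite /D (@lebesgue_tuple_box R n (fun=> `[- `|M|, `|M|]%classic)) => [|i]; last first.
    exact: measurable_itv.
  rewrite ltey_eq; apply/orP; left.
  apply: (big_ind (fun x : \bar R => x \is a fin_num)) => //.
  - by move=> x y; exact: fin_numM.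
  - by move=> i _; rewrite lebesgue_measure_itv/=; case: ifPn.
have : (lebesgue_tuple n).-integrable D (EFin \o (f \o row_of_tuple)).
  apply: measurable_bounded_integrable => //.
    apply: measurable_funTS; exact: measurable_row_of_tuple.
  exists K; split; first exact: num_real.
  move=> y Ky t Dt /=; rewrite (le_trans _ (ltW Ky))//.
  have [|/f0->] := leP `|row_of_tuple t| M; first exact: fK.
  by rewrite normr0.
move=> /(integrable_mkcond _ mD).1; apply: eq_integrable => // t _.
rewrite patchE; case: ifPn => //; rewrite notin_setE => Dt /=; rewrite f0//.
rewrite ltNge; apply/negP => tM; apply: Dt => i; rewrite /= in_itv/= -ler_norml.
rewrite (le_trans _ (ler_norm _))// (le_trans _ tM)//.
by have := ler_coord_norm (row_of_tuple t) i; rewrite mxE.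
Qed.

End compact_support.

(** * Integrals of partial derivatives with compact support *)

Section divergence.
Context {R : realType}.

(** Counterpart of [tuple_consp] for row vectors; through it Fubini for [lebesgue_tuple] acts on
    functions of row vectors. *)
Definition cons_row n (x : R) (y : 'rV[R]_n) : 'rV[R]_n.+1 :=
  \row_i oapp (fun k => y 0 k) x (unlift ord0 i).

Lemma cons_row_tuple n (x : R) (t : n.-tuple R) :
  row_of_tuple (tuple_consp (x, t)) = cons_row x (row_of_tuple t).
Proof.
apply/rowP => i; rewrite !mxE; case: unliftP => [j ->|->] /=; last first.
  by rewrite (tnth_nth 0).
by rewrite mxE tnthS.
Qed.

Lemma cons_rowD n (x x' : R) (y y' : 'rV[R]_n) :
  cons_row x y + cons_row x' y' = cons_row (x + x') (y + y').
Proof. by apply/rowP => i; rewrite !mxE; case: unliftP => [j _|_] //=; rewrite !mxE. Qed.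

Lemma cons_rowN n (x : R) (y : 'rV[R]_n) : - cons_row x y = cons_row (- x) (- y).
Proof. by apply/rowP => i; rewrite !mxE; case: unliftP => [j _|_] //=; rewrite !mxE. Qed.

Lemma cons_rowZ n (h x : R) (y : 'rV[R]_n) : h *: cons_row x y = cons_row (h * x) (h *: y).
Proof. by apply/rowP => i; rewrite !mxE; case: unliftP => [j _|_] //=; rewrite !mxE. Qed.

Lemma delta_row0 n : delta_mx 0 ord0 = cons_row 1 (0 : 'rV[R]_n).
Proof.
apply/rowP => i; rewrite !mxE /=; case: unliftP => [j ->|->] /=; last by [].
by rewrite !mxE.
Qed.

Lemma delta_row_lift n (k : 'I_n) :
  delta_mx 0 (lift ord0 k) = cons_row 0 (delta_mx 0 k : 'rV[R]_n).
Proof.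
apply/rowP => i; rewrite !mxE /=; case: unliftP => [j ->|->] /=.
  by rewrite mxE (inj_eq lift_inj).
by [].
Qed.

Lemma norm_cons_row_le n (x : R) (y : 'rV[R]_n) : `|cons_row x y| <= `|x| + `|y|.
Proof.
apply: ler_norm_coord => [|i]; first by rewrite addr_ge0.
rewrite mxE; case: unliftP => [j _|_] /=; last by rewrite lerDl.
by rewrite (le_trans (ler_coord_norm _ _))// lerDr.
Qed.

Lemma norm_le_cons_row n (x : R) (y : 'rV[R]_n) :
  `|x| <= `|cons_row x y| /\ `|y| <= `|cons_row x y|.
Proof.
split.
  by have := ler_coord_norm (cons_row x y) ord0; rewrite mxE unlift_none.
apply: ler_norm_coord => // i.
by have := ler_coord_norm (cons_row x y) (lift ord0 i); rewrite mxE liftK.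
Qed.

Lemma continuous_cons_rowr n (x : R) : continuous (@cons_row n x).
Proof.
apply: (@lipschitz_continuous_map _ _ _ _ 1) => y z.
by rewrite cons_rowN cons_rowD subrr (le_trans (norm_cons_row_le _ _))// normr0 add0r mul1r.
Qed.

Lemma continuous_cons_rowl n (y : 'rV[R]_n) : continuous (@cons_row n ^~ y).
Proof.
apply: (@lipschitz_continuous_map _ R _ _ 1) => x z.
by rewrite cons_rowN cons_rowD subrr (le_trans (norm_cons_row_le _ _))// normr0 addr0 mul1r.
Qed.

Lemma integral_derive_compact_support (g dg : R -> R) (M : R) : continuous dg ->
  (forall x, is_derive x (1 : R) g (dg x)) ->
  (forall x, M < `|x| -> g x = 0 /\ dg x = 0) ->
  (\int[@lebesgue_measure R]_x (dg x)%:E = 0)%E.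
Proof.
move=> cdg gdg gM.
(* Positive and strictly larger than [M], whatever the sign of [M], so that [g] vanishes at both
   endpoints. *)
pose N : R := `|M| + 1.
have N0 : 0 < N by rewrite ltr_wpDl.
have MN : M < N by rewrite /N (le_lt_trans (ler_norm M))// ltrDl.
have cg : continuous g.
  move=> x; apply: differentiable_continuous; apply/derivable1_diffP.
  by have [] := gdg x.
transitivity (\int[@lebesgue_measure R]_(x in `[(- N)%R, N%R]) (dg x)%:E)%E.
  rewrite [RHS]integral_mkcond; apply: eq_integral => x _.
  rewrite patchE; case: ifPn => //; rewrite notin_setE /= in_itv/= -ler_norml => /negP.
  by rewrite -ltNge => /(lt_trans MN) /gM[_ ->].
rewrite (@continuous_FTC2 _ dg g) ?gtrN//.
- have gN s : `|s| = N -> g s = 0 by move=> sN; have [|] := gM s; rewrite ?sN.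
  by rewrite !gN ?normrN ?gtr0_norm// subee.
- exact: continuous_subspaceT.
- split.
  + by move=> x _; have [] := gdg x.
  + by apply: cvg_at_right_filter; exact: cg.
  + by apply: cvg_at_left_filter; exact: cg.
- by move=> x _; rewrite derive1E; have [_ ->] := gdg x.
Qed.

(** Fubini puts the integration in direction [j] innermost. The hypotheses involve the derivative in
    that direction alone, so each component of a vector field is treated with its own partial
    derivative. *)
Lemma integral_partial_eq0 n (j : 'I_n) (g dg : 'rV[R]_n -> R) (M : R) :
  continuous dg -> (forall x, is_derive x (delta_mx 0 j) g (dg x)) ->
  (forall x, M < `|x| -> g x = 0 /\ dg x = 0) ->
  (\int[lebesgue_tuple n]_t (dg (row_of_tuple t))%:E = 0)%E.
Proof.
elim: n j g dg M => [[]//|n IHn] j g dg M cdg gdg gM.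
have idg : (lebesgue_tuple n.+1).-integrable setT (EFin \o dg \o row_of_tuple).
  by apply: (integrable_compact_support cdg) => x /gM[].
have mdg : measurable_fun [set: n.+1.-tuple R] (EFin \o dg \o row_of_tuple).
  by case/integrableP : idg.
have mc := @measurable_tuple_consp R n.
have ic : (@lebesgue_measure R \x lebesgue_tuple n)%E.-integrable setT
    (EFin \o dg \o row_of_tuple \o tuple_consp).
  apply/integrableP; split; first exact: measurableT_comp.
  case/integrableP : idg => _; rewrite [X in (X < _)%E -> _]ge0_integral_pushforward//.
  exact: measurableT_comp.
rewrite [LHS]integral_pushforward//= preimage_setT.
(* If [j] is a later coordinate, the inner integral over the later coordinates is zero by induction;
   if [j] is the first one, the inner integral over the line is zero by the fundamental theorem of
   calculus. *)
case: (unliftP ord0 j) => [k jE|jE].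
- rewrite -integral12_prod_meas1//= [LHS]integral0_eq// => x _.
  rewrite /fubini_F; under eq_integral do rewrite cons_row_tuple.
  apply: (IHn k (g \o cons_row x) (dg \o cons_row x) M).
  + move=> y; apply: continuous_comp; first exact: continuous_cons_rowr.
    exact: cdg.
  + move=> y; apply/is_derive_lineP.
    have /is_derive_lineP := gdg (cons_row x y).
    rewrite jE delta_row_lift; under [X in is_derive _ _ X]eq_fun do
      rewrite cons_rowZ cons_rowD mulr0 add0r.
    exact.
  + by move=> y My; apply: gM; rewrite (lt_le_trans My)//; case: (norm_le_cons_row x y).
- rewrite -integral21_prod_meas1//= [LHS]integral0_eq// => y _.
  rewrite /fubini_G; under eq_integral do rewrite cons_row_tuple.
  apply: (@integral_derive_compact_support (fun x => g (cons_row x (row_of_tuple y)))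
    (fun x => dg (cons_row x (row_of_tuple y))) M).
  + move=> x; apply: (@continuous_comp _ _ _ (fun x => cons_row x (row_of_tuple y)) dg).
      exact: continuous_cons_rowl.
    exact: cdg.
  + move=> x; apply/is_derive_lineP.
    have /is_derive_lineP := gdg (cons_row x (row_of_tuple y)).
    rewrite jE delta_row0; under [X in is_derive _ _ X]eq_fun do
      rewrite cons_rowZ cons_rowD scaler0 add0r.
    exact.
  + move=> x My; apply: gM; rewrite (lt_le_trans My)//.
    by have [] := norm_le_cons_row x (row_of_tuple y).
Qed.

End divergence.
(** * The Liouville principle *)

Section truncated_power.
Context {R : realType} (p eps : R).
Hypotheses (p0 : 0 < p) (p1 : p <= 1) (eps0 : 0 < eps).

(* A C^1 substitute f for t^p with t f'(t) <= p t^p uniformly in eps. *)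
Definition tpow (t : R) : R := (t + eps) `^ p - eps `^ p.

Definition dtpow (t : R) : R := p * (t + eps) `^ (p - 1).

Lemma is_derive_tpow (t : R) : 0 <= t -> is_derive t (1 : R) tpow (dtpow t).
Proof.
move=> t0; have te : 0 < t + eps by rewrite ltr_wpDl.
rewrite /tpow /dtpow.
have h1 : is_derive t (1 : R) (fun t : R => t + eps) 1.
  by apply: is_derive_eq; rewrite addr0.
have h2 := is_derive1_powR p te.
have h3 := @is_derive1_comp R (@powR R ^~ p) (fun t : R => t + eps) t _ _ h2 h1.
by apply: is_derive_eq; rewrite subr0 mulr1.
Qed.

Lemma powR_lerN (a b : R) : 0 < a -> a <= b -> b `^ (p - 1) <= a `^ (p - 1).
Proof.
move=> a0 ab; have b0 := lt_le_trans a0 ab.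
rewrite -opprB !powRN lef_pV2 ?posrE ?powR_gt0//.
by rewrite ge0_ler_powR ?subr_ge0 ?nnegrE// ltW.
Qed.

Lemma dtpow_ge0 (t : R) : 0 <= dtpow t.
Proof. by rewrite mulr_ge0 ?powR_ge0// ltW. Qed.

Lemma dtpow_le (t : R) : 0 <= t -> dtpow t <= p * eps `^ (p - 1).
Proof. by move=> t0; rewrite ler_pM2l// powR_lerN// lerDr. Qed.

(** The exponent [p - 1] is nonpositive, so [(t + eps)^(p-1) <= s^(p-1)]. Two points are kept apart
    because the derivative will be taken at an approximant [t], while the transport bound is in
    terms of the original value [s]. *)
Lemma dtpowM_le (t s : R) : 0 <= s -> s <= t + eps -> dtpow t * s <= p * s `^ p.
Proof.
rewrite le_eqVlt => /predU1P[<- _|s0 st].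
  by rewrite mulr0 mulr_ge0 ?powR_ge0// ltW.
rewrite -mulrA ler_pM2l// -(mulr_powRB1 (ltW s0) p0) mulrC ler_pM2l//.
exact: powR_lerN.
Qed.

Lemma tpow_ge0 (t : R) : 0 <= t -> 0 <= tpow t.
Proof.
have := ltW eps0; have := ltW p0 => pp ep t0.
by rewrite subr_ge0 ge0_ler_powR ?nnegrE ?addr_ge0 ?lerDr.
Qed.

(** This is the subadditivity of the power for [p <= 1]: [(t + eps)^p <= t^p + eps^p]. *)
Lemma tpow_le (t : R) : 0 <= t -> tpow t <= t `^ p.
Proof.
rewrite le_eqVlt => /predU1P[<-|t0].
  by rewrite /tpow add0r subrr powR_ge0.
have te : 0 < t + eps by rewrite addr_gt0.
(* The ratio [r = a/(a+b)] is at most 1, so [r <= r^p]; adding the inequalities for both orders of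
   [a] and [b] gives subadditivity. *)
have H a b : 0 < a -> 0 < b -> a / (a + b) * (a + b) `^ p <= a `^ p.
  move=> a0 b0; have ab0 : 0 < a + b by rewrite addr_gt0.
  rewrite -[X in _ <= X `^ _](divfK (lt0r_neq0 ab0)) powRM ?divr_ge0 ?(ltW a0) ?(ltW ab0)//.
  rewrite ler_pM2r ?powR_gt0// ger1_powR// divr_gt0//=.
  by rewrite ler_pdivrMr// mul1r lerDl ltW.
rewrite /tpow lerBlDr.
have := lerD (H _ _ t0 eps0) (H _ _ eps0 t0).
by rewrite [eps + t]addrC -!mulrDl divff ?gt_eqF// mul1r.
Qed.

(** The constant may blow up as [eps] tends to 0; the bound is used with [eps] fixed, the
    approximation error being chosen afterwards. *)
Lemma tpow_lipschitz (s t : R) : 0 <= s -> 0 <= t ->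
  `|tpow s - tpow t| <= p * eps `^ (p - 1) * `|s - t|.
Proof.
wlog st : s t / s <= t.
  move=> h s0 t0; case/orP: (le_total s t) => st; first exact: h.
  by rewrite distrC [X in _ * X]distrC h.
move=> s0 t0.
have cf x : 0 <= x -> {for x, continuous tpow}.
  move=> x0; apply: differentiable_continuous; apply/derivable1_diffP.
  by have [] := is_derive_tpow x0.
have [||x] := @MVT_segment R tpow dtpow s t st.
- move=> x; rewrite in_itv/= => /andP[/ltW sx _]; apply: is_derive_tpow; exact: le_trans sx.
- apply: continuous_in_subspaceT => y; rewrite inE /= in_itv/= => /andP[sy _].
  by apply: cf; exact: le_trans sy.
rewrite in_itv/= => /andP[sx _] tE.
rewrite distrC tE normrM [X in _ <= _ * X]distrC ler_wpM2r//.
by rewrite ger0_norm ?dtpow_ge0// dtpow_le// (le_trans s0).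
Qed.

End truncated_power.

Lemma cvg_tpow (R : realType) (p s : R) : 0 < p -> 0 <= s ->
  tpow p n.+1%:R^-1 s @[n --> \oo] --> s `^ p.
Proof.
move=> p0 s0.
have h0 : (n.+1%:R^-1 : R) @[n --> \oo] --> (0 : R) by exact: cvg_harmonic.
have hp : (n.+1%:R^-1 : R) `^ p @[n --> \oo] --> (0 : R).
  move/cvg_at_rightP : (powR_cvg0 p0); apply.
  by split => // n; rewrite invr_gt0.
rewrite -[X in _ --> X]subr0; apply: cvgB => //.
move: s0; rewrite le_eqVlt => /predU1P[<-|s0].
  by rewrite powR0 ?gt_eqF//; under eq_cvg do rewrite add0r.
have cs : {for s, continuous (@powR R ^~ p)}.
  apply: differentiable_continuous; apply/derivable1_diffP.
  by have [] := is_derive1_powR p s0.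
have hs : s + n.+1%:R^-1 @[n --> \oo] --> s.
  by rewrite -[X in _ --> X]addr0; apply: cvgD => //; exact: cvg_cst.
exact: (cvg_comp _ _ hs cs).
Qed.

(** * Directional derivatives and continuity of real functions *)

Section calculus.
Context {R : realType}.

(** Reduces a derivative to a remainder bound, the form in which averages of increments are
    estimated later. *)
Lemma is_derive_approx (E : normedModType R) (f : E -> R) (a v : E) (d : R) :
  (forall e : R, 0 < e -> exists2 r : R, 0 < r &
    forall h, `|h| < r -> `|f (h *: v + a) - f a - h * d| <= e * `|h|) ->
  is_derive a v f d.
Proof.
move=> fd.
have cf : h^-1 *: (f (h *: v + a) - f a) @[h --> 0^'] --> d.
  apply/cvgrPdist_le => e e0; have [r r0 H] := fd e e0.
  have h0 := nbhs_dnbhs_neq (0 : R).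
  near=> h.
  have hn0 : h != 0 by near: h; exact: nbhs_dnbhs_neq.
  have hr : `|h| < r by near: h; exact: dnbhs0_lt.
  have -> : d - h^-1 *: (f (h *: v + a) - f a) = - (h^-1 * (f (h *: v + a) - f a - h * d)).
    rewrite (_ : h^-1 *: _ = h^-1 * (f (h *: v + a) - f a))//.
    by field.
  rewrite normrN normrM normfV mulrC ler_pdivrMr ?normr_gt0//; exact: H.
apply: DeriveDef; first by apply/cvg_ex; exists d.
exact/cvg_lim.
Unshelve. all: by end_near. Qed.

Lemma is_derive_comp_real (E : normedModType R) (f : R -> R) (g : E -> R) a v df dg :
  is_derive (g a) (1 : R) f df -> is_derive a v g dg ->
  is_derive a v (fun x => f (g x)) (df * dg).
Proof.
move=> fdf /is_derive_lineP gdg; apply/is_derive_lineP.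
apply: (@is_derive1_comp R f (fun h : R => g (h *: v + a))) => //.
by rewrite scale0r add0r.
Qed.

Lemma is_derive_mul (E : normedModType R) (f g : E -> R) a v df dg :
  is_derive a v f df -> is_derive a v g dg ->
  is_derive a v (fun x => f x * g x) (df * g a + f a * dg).
Proof.
by move=> h1 h2; apply: is_derive_eq; rewrite addrC; congr (_ + _); exact: mulrC.
Qed.

Lemma is_derive_coord n (a v : 'rV[R]_n) i : is_derive a v (fun x : 'rV[R]_n => x 0 i) (v 0 i).
Proof.
apply: is_derive_approx => e e0; exists 1 => // h _.
by rewrite !mxE addrK subrr normr0 mulr_ge0// ltW.
Qed.

Lemma is_derive_bigsum n (E W : normedModType R) (f : 'I_n -> E -> W) (df : 'I_n -> W) a v :
  (forall i, is_derive a v (f i) (df i)) ->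
  is_derive a v (fun x => \sum_(i < n) f i x) (\sum_(i < n) df i).
Proof.
move=> h; have := is_derive_sum h.
rewrite (_ : (\sum_(i < n) f i) = fun x => \sum_(i < n) f i x)//.
by apply/funext => x; rewrite fct_sumE.
Qed.

Definition posp (z : R) : R := Num.max 0 z.

Lemma posp_ge0 z : 0 <= posp z. Proof. by rewrite le_max lexx. Qed.

(** Squaring smooths the corner of the positive part: whatever the signs of [x] and [h + x], the
    first-order remainder is at most [h^2]. *)
Lemma is_derive_posp_sqr (x : R) : is_derive x (1 : R) (fun z => posp z ^+ 2) (2 * posp x).
Proof.
apply: is_derive_approx => e e0; exists e => // h he.
apply: (@le_trans _ _ (h ^+ 2)); last first.
  by rewrite -real_normK ?num_real// expr2 ler_wpM2r// ltW.
rewrite /posp scaler1; case: (leP 0 (h + x)) => h1; case: (leP 0 x) => h2.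
- by rewrite (_ : _ - _ = h ^+ 2) ?ger0_norm ?sqr_ge0//; ring.
- rewrite ler_norml; nra.
- rewrite ler_norml; nra.
- by rewrite !expr0n/= !mulr0 !subr0 normr0 sqr_ge0.
Qed.

Lemma continuous_posp : continuous posp.
Proof.
move=> x; apply: (@cvg_trans _ _) => //.
apply: (@lipschitz_continuous_map R _ _ posp 1) => {x}.
move=> x y; rewrite mul1r /posp; case: (leP 0 x) => h1; case: (leP 0 y) => h2 //.
- rewrite subr0 ger0_norm// ler_normr; lra.
- rewrite sub0r normrN ger0_norm// ler_normr; lra.
- by rewrite subrr normr0.
Qed.

Lemma continuous_add (T : topologicalType) (f g : T -> R) :
  continuous f -> continuous g -> continuous (fun x => f x + g x).
Proof. by move=> cf cg x; apply: cvgD; [exact: cf|exact: cg]. Qed.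

Lemma continuous_opp (T : topologicalType) (f : T -> R) :
  continuous f -> continuous (fun x => - f x).
Proof. by move=> cf x; apply: cvgN; exact: cf. Qed.

Lemma continuous_mul (T : topologicalType) (f g : T -> R) :
  continuous f -> continuous g -> continuous (fun x => f x * g x).
Proof. by move=> cf cg x; apply: cvgM; [exact: cf|exact: cg]. Qed.

Lemma continuous_sumr (T : topologicalType) (I : Type) (r : seq I) (f : I -> T -> R) :
  (forall i, continuous (f i)) -> continuous (fun x => \sum_(i <- r) f i x).
Proof.
move=> cf; elim: r => [|i r IH].
  by under eq_fun do rewrite big_nil; exact: cst_continuous.
by under eq_fun do rewrite big_cons; exact: continuous_add.
Qed.

Lemma continuous_norm (T : topologicalType) (f : T -> R) :
  continuous f -> continuous (fun x => `|f x|).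
Proof. by move=> cf x; apply: cvg_norm; exact: cf. Qed.

Lemma continuous_compr (T : topologicalType) (f : R -> R) (g : T -> R) :
  (forall x, {for g x, continuous f}) -> continuous g -> continuous (fun x => f (g x)).
Proof. by move=> cf cg x; apply: continuous_comp; [exact: cg|exact: cf]. Qed.

Lemma continuous_coord n i : continuous (fun x : 'rV[R]_n => x 0 i).
Proof.
apply: (@lipschitz_continuous_map R _ _ _ 1) => x y; rewrite mul1r.
by rewrite (le_trans _ (ler_coord_norm _ i))// !mxE.
Qed.

End calculus.

(** * A polynomial cutoff function *)

Section cutoff.
Context {R : realType} {n : nat}.
Local Notation rV := 'rV[R]_n.
Implicit Types (m : R) (x : rV).

Definition sqnorm (x : rV) : R := \sum_(i < n) x 0 i ^+ 2.
(** The squared positive part of [1 - |x|^2/m^2] (Euclidean norm) is C^1, supported in the ball of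
    radius [m], and has an explicit gradient of order [|x|/m^2], which compensates the linear growth
    of the transporting field. *)
Definition cutoff (m : R) (x : rV) : R := posp (1 - sqnorm x / m ^+ 2) ^+ 2.
Definition dcutoff (m : R) (j : 'I_n) (x : rV) : R :=
  2 * posp (1 - sqnorm x / m ^+ 2) * (- (2 * x 0 j / m ^+ 2)).
Lemma continuous_sqnorm : continuous sqnorm.
Proof.
apply: continuous_sumr => i; under eq_fun do rewrite expr2.
by apply: continuous_mul; exact: continuous_coord.
Qed.

Lemma continuous_posp_sqnorm m : continuous (fun x => posp (1 - sqnorm x / m ^+ 2)).
Proof.
apply: continuous_compr; first by move=> x; exact: continuous_posp.
apply: continuous_add; first exact: cst_continuous.
apply: continuous_opp; apply: continuous_mul; last exact: cst_continuous.
exact: continuous_sqnorm.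
Qed.

Lemma continuous_cutoff m : continuous (cutoff m).
Proof.
rewrite /cutoff; under eq_fun do rewrite expr2.
by apply: continuous_mul; exact: continuous_posp_sqnorm.
Qed.

Lemma continuous_dcutoff m j : continuous (dcutoff m j).
Proof.
apply: continuous_mul.
  apply: continuous_mul; first exact: cst_continuous.
  exact: continuous_posp_sqnorm.
apply: continuous_opp; apply: continuous_mul; last exact: cst_continuous.
by apply: continuous_mul; [exact: cst_continuous|exact: continuous_coord].
Qed.

Lemma is_derive_sqnorm x j : is_derive x (delta_mx 0 j) sqnorm (2 * x 0 j).
Proof.
have : is_derive x (delta_mx 0 j) sqnorm
    (\sum_(i < n) (2 * x 0 i * (delta_mx 0 j : rV) 0 i)).
  apply: is_derive_bigsum => i; have h := is_derive_coord x (delta_mx 0 j) i.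
  under eq_fun do rewrite expr2.
  have := is_derive_mul h h.
  by rewrite (_ : _ + _ = 2 * x 0 i * (delta_mx 0 j : rV) 0 i)//; ring.
rewrite (bigD1 j)//= mxE !eqxx/= mulr1 big1 ?addr0// => i ij.
by rewrite mxE/= (negbTE ij) mulr0.
Qed.

Lemma is_derive_cutoff m x j : is_derive x (delta_mx 0 j) (cutoff m) (dcutoff m j x).
Proof.
have h := is_derive_sqnorm x j.
have h1 : is_derive x (delta_mx 0 j) (fun y => 1 - sqnorm y / m ^+ 2)
    (- (2 * x 0 j / m ^+ 2)).
  have h2 := is_derive_mul h (is_derive_cst (m ^- 2) x (delta_mx 0 j)).
  have h3 := is_deriveB (is_derive_cst (1 : R) x (delta_mx 0 j)) h2.
  by apply: is_derive_eq h3 _; rewrite mulr0 addr0 sub0r.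
exact: (is_derive_comp_real (is_derive_posp_sqr _) h1).
Qed.

(** [|x|] is the maximum norm whereas [sqnorm] is Euclidean; the comparison lets supports be stated
    with [|x|]. *)
Definition sqnorm_ge x : `|x| ^+ 2 <= sqnorm x.
Proof.
suff : `|x| <= Num.sqrt (sqnorm x).
  rewrite -[X in _ -> _ <= X](@sqr_sqrtr _ (sqnorm x)); last first.
    by apply: sumr_ge0 => i _; exact: sqr_ge0.
  by move=> h; rewrite ler_pXn2r ?nnegrE ?sqrtr_ge0.
apply: ler_norm_coord => [|i]; first exact: sqrtr_ge0.
rewrite -sqrtr_sqr ler_sqrt; last by apply: sumr_ge0 => k _; exact: sqr_ge0.
by rewrite /sqnorm (bigD1 i)//= lerDl sumr_ge0// => k _; exact: sqr_ge0.
Qed.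

Lemma posp_eq0 m x : 0 < m -> m <= `|x| -> posp (1 - sqnorm x / m ^+ 2) = 0.
Proof.
move=> m0 mx; rewrite /posp max_l// subr_le0 ler_pdivlMr ?exprn_gt0// mul1r.
by rewrite (le_trans _ (sqnorm_ge x))// ler_pXn2r ?nnegrE// ltW.
Qed.

Lemma cutoff_eq0 m x : 0 < m -> m <= `|x| -> cutoff m x = 0.
Proof. by move=> m0 mx; rewrite /cutoff posp_eq0// expr0n. Qed.

Lemma dcutoff_eq0 m j x : 0 < m -> m <= `|x| -> dcutoff m j x = 0.
Proof. by move=> m0 mx; rewrite /dcutoff posp_eq0// mulr0 mul0r. Qed.

Lemma posp_le1 m x : posp (1 - sqnorm x / m ^+ 2) <= 1.
Proof.
rewrite /posp ge_max ler01/= lerBlDr lerDl divr_ge0 ?sqr_ge0//.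
by apply: sumr_ge0 => i _; exact: sqr_ge0.
Qed.

Lemma cutoff_itv m x : 0 <= cutoff m x <= 1.
Proof. by rewrite /cutoff sqr_ge0/= exprn_ile1 ?posp_ge0 ?posp_le1. Qed.

Lemma cvg_cutoff x : cutoff k.+1%:R x @[k --> \oo] --> (1 : R).
Proof.
have h0 : (k.+1%:R^-1 : R) @[k --> \oo] --> (0 : R) by exact: cvg_harmonic.
have h1 : 1 - sqnorm x / k.+1%:R ^+ 2 @[k --> \oo] --> (1 : R).
  rewrite -[X in _ --> X]subr0; apply: cvgB; first exact: cvg_cst.
  rewrite -(mulr0 (sqnorm x)); apply: cvgM; first exact: cvg_cst.
  have h00 : k.+1%:R^-1 * k.+1%:R^-1 @[k --> \oo] --> (0 * 0 : R) by exact: cvgM.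
  rewrite mulr0 in h00.
  by under eq_cvg do rewrite expr2 invfM.
have h2 : posp (1 - sqnorm x / k.+1%:R ^+ 2) @[k --> \oo] --> (1 : R).
  have := cvg_comp _ _ h1 (@continuous_posp R 1).
  by rewrite {2}/posp max_r.
rewrite /cutoff -[X in _ --> X]mulr1; under eq_cvg do rewrite expr2.
exact: cvgM.
Qed.

End cutoff.

(** * The Liouville principle for one nonnegative function *)

Section liouville.
Context {R : realType} {n : nat}.
Local Notation rV := 'rV[R]_n.

(** Were [s] positive at [x0], it would stay above half that value on a ball, and balls have
    positive measure. *)
Lemma nonneg_powR_integral_eq0 (s : rV -> R) (p : R) : continuous s -> 0 < p ->
  (forall x, 0 <= s x) ->
  (\int[lebesgue_tuple n]_t (s (row_of_tuple t) `^ p)%:E <= 0)%E ->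
  forall x, s x = 0.
Proof.
move=> cs p0 s0 I0 x0; apply/eqP; rewrite eq_le s0 andbT leNgt; apply/negP => sx0.
have [e /= e0 es] : exists2 e : R, 0 < e & forall y, ball x0 e y -> s x0 / 2 <= s y.
  have : nbhs x0 [set y | s x0 / 2 < s y].
    apply: (cs x0 [set z | s x0 / 2 < z]); apply: open_nbhs_nbhs; split.
      exact: open_gt.
    by rewrite /= ltr_pdivrMr// ltr_pMr// ltr1n.
  by move=> /nbhs_ballP[e e0 H]; exists e => // y /H /ltW.
pose c := (s x0 / 2) `^ p.
have c0 : 0 < c by rewrite powR_gt0 ?divr_gt0.
pose D := [set t : n.-tuple R | ball x0 e (row_of_tuple t)].
have mD : measurable D by exact: measurable_box.
have muD : (0 < lebesgue_tuple n D)%E.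
  rewrite (_ : D = [set t | forall i, ball (x0 0 i) e (tnth t i)]); last first.
    apply/seteqP; split => t /=.
      by move=> [_ xt] i; have := xt 0 i; rewrite mxE.
    by move=> xt; split => // i j; rewrite (ord1 i) mxE; exact: xt.
  rewrite (@lebesgue_tuple_box R n (fun i => ball (x0 0 i) e)); last first.
    by move=> i; exact: measurable_ball.
  apply: (big_ind (fun x : \bar R => (0 < x)%E)) => //.
  - by move=> x y; exact: mule_gt0.
  - by move=> i _; rewrite lebesgue_measure_ball ?ltW// lte_fin mulrn_wgt0.
have : (0 < \int[lebesgue_tuple n]_t (s (row_of_tuple t) `^ p)%:E)%E.
  apply: (@lt_le_trans _ _ (\int[lebesgue_tuple n]_(t in D) c%:E)%E).
    by rewrite integral_cst//= mule_gt0.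
  have ms : measurable_fun [set: n.-tuple R] (fun t => (s (row_of_tuple t) `^ p)%:E).
    apply/measurable_EFinP; apply: (measurableT_comp (measurable_powR p)).
    exact: measurable_row_of_tuple.
  apply: (@le_trans _ _ (\int[lebesgue_tuple n]_(t in D) (s (row_of_tuple t) `^ p)%:E)%E).
    apply: ge0_le_integral => //.
    - by move=> t _; rewrite lee_fin ltW.
    - exact: measurable_funTS.
    - move=> t Dt; rewrite lee_fin ge0_ler_powR ?nnegrE ?divr_ge0 ?(ltW p0)//.
      exact: es.
  by apply: ge0_subset_integral => // t _; rewrite lee_fin powR_ge0.
by rewrite ltNge I0.
Qed.

Variables (w : rV -> rV) (dw : 'I_n -> rV -> R) (d C K : R) (s : rV -> R).
Hypothesis cw : forall j, continuous (fun x => w x 0 j).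
Hypothesis wdw : forall j x, is_derive x (delta_mx 0 j) (fun y => w y 0 j) (dw j x).
Hypothesis cdw : forall j, continuous (dw j).
Hypothesis divw : forall x, \sum_(j < n) dw j x = d.
Hypothesis d0 : d != 0.
Hypothesis wC : forall x, `|w x| <= C * (1 + `|x|).
Hypothesis K0 : 0 <= K.
Hypothesis cs : continuous s.
Hypothesis s0 : forall x, 0 <= s x.
(** Weak form of [|w.grad s| <= K s] for a merely continuous [s]. The error [e] is uniform over the
    whole space, while the size of [ds'] may depend on [e] in any way. *)
Hypothesis s_approx : forall e : R, 0 < e ->
  exists (s' : rV -> R) (ds' : 'I_n -> rV -> R),
    [/\ continuous s', forall j, continuous (ds' j),
     forall j x, is_derive x (delta_mx 0 j) s' (ds' j x),
     forall x, 0 <= s' x &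
     forall x, `|s' x - s x| <= e /\
       `|\sum_(j < n) w x 0 j * ds' j x| <= K * s x + e].

Let wcut (m : R) (x : rV) : R := \sum_(j < n) w x 0 j * dcutoff m j x.

Let continuous_wcut m : continuous (wcut m).
Proof.
apply: continuous_sumr => j.
by apply: continuous_mul; [exact: cw|exact: continuous_dcutoff].
Qed.

Let wcut_eq0 m x : 0 < m -> m <= `|x| -> wcut m x = 0.
Proof. by move=> m0 mx; rewrite /wcut big1// => j _; rewrite dcutoff_eq0// mulr0. Qed.

Let C_ge0 : 0 <= C.
Proof. by have := le_trans (normr_ge0 _) (wC 0); rewrite normr0 addr0 mulr1. Qed.

(** Where the cutoff is active, [|x| < m] and [1 <= m] give [|w_j| <= 2 C m], and the derivative of
    the cutoff is at most [4/m]; each of the [n] coordinates contributes at most [8 C]. *)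
Let wcut_le m x : 1 <= m -> `|wcut m x| <= n%:R * (8 * C).
Proof.
move=> m1; have m0 : 0 < m by rewrite (lt_le_trans ltr01).
have [xm|mx] := ltP `|x| m; last first.
  by rewrite wcut_eq0// normr0 mulr_ge0// mulr_ge0 ?C_ge0.
rewrite (le_trans (ler_norm_sum _ _ _))//.
rewrite -[X in X%:R * _](card_ord n) -sum1_card natr_sum mulr_suml ler_sum// => j _.
rewrite mul1r normrM /dcutoff !normrM normrN !normrM normfV normrX.
have a1 : `|w x 0 j| <= C * (2 * m).
  rewrite (le_trans (ler_coord_norm _ _))// (le_trans (wC x))// ler_wpM2l ?C_ge0//.
  lra.
have a2 : `|x 0 j| <= m by rewrite (le_trans (ler_coord_norm _ _))// ltW.
have a3 : `|posp (1 - sqnorm x / m ^+ 2)| <= 1 by rewrite ger0_norm ?posp_ge0 ?posp_le1.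
rewrite (ger0_norm (ltW m0)) (ger0_norm (_ : 0 <= 2))//.
have -> : 8 * C = C * (2 * m) * (2 * 1 * (2 * m / m ^+ 2)) by field; rewrite gt_eqF.
apply: ler_pM => //; first by rewrite !mulr_ge0// invr_ge0 sqr_ge0.
apply: ler_pM => //; first by rewrite mulr_ge0// invr_ge0 sqr_ge0.
  by apply: ler_pM.
by rewrite ler_wpM2r ?invr_ge0 ?sqr_ge0// ler_wpM2l.
Qed.

(** At a fixed point the gradient of the cutoff is of order [m^-2]; the cruder rate [1/m]
    suffices. *)
Let cvg_wcut x : wcut k.+1%:R x @[k --> \oo] --> (0 : R).
Proof.
have h0 : (k.+1%:R^-1 : R) @[k --> \oo] --> (0 : R) by exact: cvg_harmonic.
apply: norm_cvg0.
pose c := \sum_(j < n) `|w x 0 j| * (2 * (2 * `|x 0 j|)).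
apply: (@squeeze_cvgr _ _ _ _ (cst 0) (fun k => c * k.+1%:R^-1)); last 2 first.
- exact: cvg_cst.
- by rewrite -(mulr0 c); apply: cvgM => //; exact: cvg_cst.
apply: nearW => k; rewrite /= normr_ge0/= (le_trans (ler_norm_sum _ _ _))//.
rewrite /c mulr_suml ler_sum// => j _.
rewrite normrM -mulrA ler_wpM2l// /dcutoff !normrM normrN !normrM normfV normrX.
have a3 : `|posp (1 - sqnorm x / k.+1%:R ^+ 2)| <= 1 by rewrite ger0_norm ?posp_ge0 ?posp_le1.
rewrite (ger0_norm (_ : 0 <= 2))// (ger0_norm (_ : 0 <= k.+1%:R))//.
have -> : 2 * (2 * `|x 0 j|) / k.+1%:R = 2 * 1 * (2 * `|x 0 j| * k.+1%:R^-1) by ring.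
apply: ler_pM => //; first by apply: ler_pM.
rewrite ler_wpM2l ?mulr_ge0// lef_pV2 ?posrE ?exprn_gt0//.
by rewrite expr2 ler_peMl// ler1n.
Qed.


Variables (p : R).
Hypotheses (p0 : 0 < p) (p1 : p <= 1).
Hypothesis s_int : (\int[lebesgue_tuple n]_t (s (row_of_tuple t) `^ p)%:E < +oo)%E.

Let mpow : measurable_fun [set: n.-tuple R] (fun t => s (row_of_tuple t) `^ p).
Proof.
apply: (measurableT_comp (measurable_powR p)).
exact: measurable_row_of_tuple.
Qed.

Let ipow : (lebesgue_tuple n).-integrable setT (fun t => (s (row_of_tuple t) `^ p)%:E).
Proof.
apply/integrableP; split; first exact/measurable_EFinP.
by under eq_integral do rewrite gee0_abs ?lee_fin ?powR_ge0//.
Qed.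

(** Formal lower bound for [sg d] times the divergence of [chi f(s) w], where [chi] is the cutoff
    and [f = tpow p eps]: the main term comes from [div w = d], the losses from the cutoff and from
    the transport of [s]. Its limit for large [m] and small [eps] is [(|d| - K p) s^p]. *)
Let g (m eps : R) (x : rV) : R :=
  `|d| * (cutoff m x * tpow p eps (s x)) - `|wcut m x| * s x `^ p -
  cutoff m x * (K * (p * s x `^ p)).

(** Compactly supported weight collecting every error term of size [eta]. *)
Let u (m : R) (x : rV) : R := (`|d| + 1) * cutoff m x + `|wcut m x|.

Let B : R := `|d| + n%:R * (8 * C) + K * p.

Let g_le m eps x : 0 < eps -> 1 <= m -> `|g m eps x| <= B * s x `^ p.
Proof.
move=> eps0 m1; have P0 : 0 <= s x `^ p by exact: powR_ge0.
have /andP[c0 c1] := cutoff_itv m x.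
have ct0 : 0 <= cutoff m x * tpow p eps (s x).
  by apply: mulr_ge0 => //; exact: tpow_ge0.
have t1 : `| `|d| * (cutoff m x * tpow p eps (s x))| <= `|d| * s x `^ p.
  rewrite normrM normr_id ler_wpM2l// ger0_norm//.
  by rewrite -[leRHS]mul1r ler_pM ?tpow_ge0 ?tpow_le.
have t2 : `| `|wcut m x| * s x `^ p| <= n%:R * (8 * C) * s x `^ p.
  by rewrite normrM normr_id (ger0_norm P0) ler_wpM2r// wcut_le.
have t3 : `|cutoff m x * (K * (p * s x `^ p))| <= K * p * s x `^ p.
  have Q0 : 0 <= K * (p * s x `^ p).
    by apply: mulr_ge0 => //; apply: mulr_ge0 => //; exact: ltW.
  by rewrite -mulrA normrM !ger0_norm// -[leRHS]mul1r ler_wpM2r.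
have -> : B * s x `^ p = `|d| * s x `^ p + n%:R * (8 * C) * s x `^ p + K * p * s x `^ p.
  by rewrite /B; ring.
by rewrite (le_trans (ler_normB _ _))// lerD// (le_trans (ler_normB _ _))// lerD.
Qed.

Let mg m eps : 0 < eps -> measurable_fun [set: n.-tuple R] (g m eps \o row_of_tuple).
Proof.
move=> eps0; have mc : measurable_fun [set: n.-tuple R] (cutoff m \o row_of_tuple).
  by apply: measurable_row_of_tuple; exact: continuous_cutoff.
apply: measurable_funB; last first.
  apply: measurable_funM => //; apply: measurable_funM => //; exact: measurable_funM.
apply: measurable_funB.
  apply: measurable_funM => //; apply: measurable_funM => //.
  apply: measurable_funB => //; apply: (measurableT_comp (measurable_powR p)).
  apply: measurable_funD => //; exact: measurable_row_of_tuple.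
apply: measurable_funM => //; apply: (measurableT_comp (@normr_measurable R setT)).
exact: measurable_row_of_tuple.
Qed.

Let iB : (lebesgue_tuple n).-integrable setT (fun t => (B * s (row_of_tuple t) `^ p)%:E).
Proof. by under eq_fun do rewrite EFinM; exact: integrableZl. Qed.

Let ig m eps : 0 < eps -> 1 <= m ->
  (lebesgue_tuple n).-integrable setT (EFin \o (g m eps \o row_of_tuple)).
Proof.
move=> eps0 m1; apply: le_integrable iB => //.
  by apply/measurable_EFinP; exact: mg.
by move=> t _ /=; rewrite lee_fin (le_trans (g_le _ _ _))// ler_norm.
Qed.

Let cu m : continuous (u m).
Proof.
apply: continuous_add; last exact/continuous_norm/continuous_wcut.
by apply: continuous_mul; [exact: cst_continuous|exact: continuous_cutoff].
Qed.

Let iu m : 0 < m -> (lebesgue_tuple n).-integrable setT (EFin \o u m \o row_of_tuple).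
Proof.
move=> m0; apply: (@integrable_compact_support _ _ _ m); first exact: cu.
by move=> x /ltW mx; rewrite /u cutoff_eq0// wcut_eq0// mulr0 normr0 addr0.
Qed.

(** The field [chi f(s') w], with [s'] an approximant of [s], is C^1 with compact support, so its
    divergence [h] has integral zero; pointwise, [g] is at most [sg d * h] plus [eta u]. The number
    [eta] can be chosen after [m] and [eps]. *)
Let transport_step m eps eta : 1 <= m -> 0 < eps -> 0 < eta ->
  (\int[lebesgue_tuple n]_t (g m eps (row_of_tuple t))%:E <=
   eta%:E * \int[lebesgue_tuple n]_t (u m (row_of_tuple t))%:E)%E.
Proof.
move=> m1 eps0 eta0; have m0 : 0 < m by rewrite (lt_le_trans ltr01).
pose L : R := p * eps `^ (p - 1).
have L0 : 0 <= L by rewrite mulr_ge0 ?powR_ge0// ltW.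
(* [e <= eps] guarantees [s <= s' + eps], as [dtpowM_le] requires; [L e <= eta] bounds both the
   change from [f(s)] to [f(s')] and the contribution of [e] to the transport term. *)
pose e := Num.min eps (eta / (L + 1)).
have e0 : 0 < e by rewrite lt_min eps0 divr_gt0// ltr_wpDl.
have eeps : e <= eps by rewrite ge_min lexx.
have Le : L * e <= eta.
  apply: (@le_trans _ _ ((L + 1) * (eta / (L + 1)))).
    by apply: ler_pM; rewrite ?(ltW e0)// ?lerDl// ge_min lexx orbT.
  by rewrite mulrC divfK// gt_eqF// ltr_wpDl.
have [s' [ds' [cs' cds' sds' s'0 s'P]]] := s_approx e0.
pose X j x := cutoff m x * tpow p eps (s' x) * w x 0 j.
pose dX j x := (dcutoff m j x * tpow p eps (s' x) +
   cutoff m x * (dtpow p eps (s' x) * ds' j x)) * w x 0 j +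
   cutoff m x * tpow p eps (s' x) * dw j x.
have XdX j x : is_derive x (delta_mx 0 j) (X j) (dX j x).
  have h1 := is_derive_comp_real (is_derive_tpow p eps0 (s'0 x)) (sds' j x).
  exact: (is_derive_mul (is_derive_mul (is_derive_cutoff m x j) h1) (wdw j x)).
have ct : continuous (fun x => tpow p eps (s' x)).
  apply: continuous_compr => // x.
  apply: differentiable_continuous; apply/derivable1_diffP.
  by have [] := is_derive_tpow p eps0 (s'0 x).
have cdt : continuous (fun x => dtpow p eps (s' x)).
  apply: continuous_mul; first exact: cst_continuous.
  apply: (@continuous_compr _ _ (@powR R ^~ (p - 1)) (fun x => s' x + eps)).
    move=> x; apply: differentiable_continuous; apply/derivable1_diffP.
    have sx : 0 < s' x + eps by rewrite ltr_wpDl.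
    by have [] := is_derive1_powR (p - 1) sx.
  by apply: continuous_add => //; exact: cst_continuous.
have cdX j : continuous (dX j).
  apply: continuous_add; apply: continuous_mul; [|exact: cw| |exact: cdw].
    apply: continuous_add; apply: continuous_mul => //.
    - exact: continuous_dcutoff.
    - exact: continuous_cutoff.
    - exact: continuous_mul.
  by apply: continuous_mul => //; exact: continuous_cutoff.
have dX0 j x : m < `|x| -> X j x = 0 /\ dX j x = 0.
  move=> /ltW mx; rewrite /X /dX cutoff_eq0// dcutoff_eq0//.
  by rewrite !(mul0r, addr0).
have iX j : (\int[lebesgue_tuple n]_t (dX j (row_of_tuple t))%:E = 0)%E.
  exact: (integral_partial_eq0 (cdX j) (XdX j) (dX0 j)).
have idX j : (lebesgue_tuple n).-integrable setT (EFin \o dX j \o row_of_tuple).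
  by apply: (integrable_compact_support (cdX j)) => x /(dX0 j)[].
pose h x := \sum_(j < n) dX j x.
have ih : (lebesgue_tuple n).-integrable setT (EFin \o h \o row_of_tuple).
  apply: (@integrable_compact_support _ _ _ m).
    by apply: continuous_sumr.
  by move=> x mx; rewrite /h big1// => j _; have [] := dX0 j _ mx.
have Ih : (\int[lebesgue_tuple n]_t (h (row_of_tuple t))%:E = 0)%E.
  under eq_integral do rewrite /h -sumEFin.
  by rewrite integral_sum//= big1.
have hE x : h x = tpow p eps (s' x) * wcut m x +
    cutoff m x * (dtpow p eps (s' x) * \sum_(j < n) w x 0 j * ds' j x) +
    d * (cutoff m x * tpow p eps (s' x)).
  rewrite /h /dX big_split/= -mulr_sumr divw; congr (_ + _); last by rewrite mulrC.
  rewrite /wcut !mulr_sumr -big_split/=; apply: eq_bigr => j _; ring.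
(* Multiplication by [sg d] gives the divergence term the factor [|d|]; the other two terms of [h],
   of unknown sign, are bounded below by minus their absolute values. *)
have key x : g m eps x <= Num.sg d * h x + eta * u m x.
  have /andP[c0 c1] := cutoff_itv m x.
  have [se qe] := s'P x.
  set q := \sum_(j < n) _ in qe hE.
  have P0 : 0 <= s x `^ p by exact: powR_ge0.
  have lip : `|tpow p eps (s' x) - tpow p eps (s x)| <= eta.
    rewrite (le_trans (tpow_lipschitz _ _ _ _ _))// (le_trans _ Le)//.
    by rewrite ler_wpM2l.
  have aP : tpow p eps (s x) <= s x `^ p by exact: tpow_le.
  have b0 : 0 <= tpow p eps (s' x) by exact: tpow_ge0.
  have D0 : 0 <= dtpow p eps (s' x) by exact: dtpow_ge0.
  have Dq : dtpow p eps (s' x) * `|q| <= K * (p * s x `^ p) + eta.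
    rewrite (le_trans (ler_wpM2l D0 qe))// mulrDr lerD//.
      rewrite mulrCA ler_wpM2l// dtpowM_le//.
      by move: se; rewrite ler_norml => /andP[]; lra.
    by rewrite (le_trans _ Le)// ler_wpM2r ?(ltW e0)// dtpow_le.
  rewrite /g /u hE -/q.
  move: lip aP b0 D0 Dq c0 c1; set b := tpow p eps (s' x); set a := tpow p eps (s x).
  set D := dtpow _ _ _; set P := s x `^ p; set W := wcut m x; set c := cutoff m x.
  rewrite ler_norml => /andP[l1 l2] aP b0 D0 Dq c0 c1.
  clearbody b a D P W c.
  have sgN y : - `|y| <= Num.sg d * y.
    have : `|Num.sg d * y| <= `|y| by rewrite normrM normr_sg d0 mul1r.
    by rewrite ler_norml => /andP[].
  have h1 : - (b * `|W|) <= Num.sg d * (b * W).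
    by rewrite (le_trans _ (sgN _))// normrM ger0_norm.
  have h2 : - (c * (D * `|q|)) <= Num.sg d * (c * (D * q)).
    by rewrite (le_trans _ (sgN _))// normrM (ger0_norm c0) normrM (ger0_norm D0).
  have h3 y : Num.sg d * (d * y) = `|d| * y by rewrite [in RHS]normrEsg mulrA.
  rewrite !mulrDr h3.
  have k1 : `|d| * (c * a) <= `|d| * (c * b) + eta * (`|d| * c).
    have -> : `|d| * (c * b) + eta * (`|d| * c) = `|d| * (c * (b + eta)) by ring.
    by rewrite ler_wpM2l// ler_wpM2l//; lra.
  have k2 : b * `|W| <= `|W| * P + eta * `|W|.
    by rewrite [`|W| * P]mulrC -mulrDl ler_wpM2r//; lra.
  have k3 : c * (D * `|q|) <= c * (K * (p * P)) + eta * c.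
    by rewrite [eta * c]mulrC -mulrDr ler_wpM2l.
  have -> : eta * ((`|d| + 1) * c) = eta * (`|d| * c) + eta * c by ring.
  lra.
have isg : (lebesgue_tuple n).-integrable setT
    (fun t => ((Num.sg d)%:E * (h (row_of_tuple t))%:E)%E) by exact: integrableZl.
have ieu : (lebesgue_tuple n).-integrable setT
    (fun t => (eta%:E * (u m (row_of_tuple t))%:E)%E).
  by apply: integrableZl => //; exact: iu.
apply: (@le_trans _ _ (\int[lebesgue_tuple n]_t
    ((Num.sg d)%:E * (h (row_of_tuple t))%:E + eta%:E * (u m (row_of_tuple t))%:E))%E).
  apply: le_integral => //; first exact: ig.
    exact: integrableD.
  by move=> t _; rewrite -!EFinM -EFinD lee_fin; exact: key.
rewrite integralD//= !integralZl//; last exact: iu.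
by rewrite Ih mule0 add0e.
Qed.


(** With [m = k + 1] and [eps = 1/(k + 1)], dominated convergence shows that [|d| - K p] times the
    integral of [s^p] is at most 0, and the factor is positive. *)
Lemma transport_liouville : K * p < `|d| -> forall x, s x = 0.
Proof.
move=> Kp; apply: (@nonneg_powR_integral_eq0 s p) => //.
have dKp : 0 < `|d| - K * p by rewrite subr_gt0.
pose f_ (k : nat) (t : n.-tuple R) := (g k.+1%:R k.+1%:R^-1 (row_of_tuple t))%:E.
pose f (t : n.-tuple R) := ((`|d| - K * p) * s (row_of_tuple t) `^ p)%:E.
have k1 (k : nat) : 1 <= k.+1%:R :> R by rewrite ler1n.
have k0 (k : nat) : 0 < k.+1%:R^-1 :> R by [].
have up k : (\int[lebesgue_tuple n]_t f_ k t <= (k.+1%:R^-1)%:E)%E.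
  have /(integrable_fin_num measurableT)/fineK := iu (lt_le_trans ltr01 (k1 k)).
  set U := fine _ => UE.
  have U0 : 0 <= U.
    rewrite /U fine_ge0// integral_ge0// => t _; rewrite lee_fin /= addr_ge0//.
    by rewrite mulr_ge0// ?addr_ge0//; have /andP[] := cutoff_itv k.+1%:R (row_of_tuple t).
  have U1 : 0 < 1 + U by rewrite ltr_pwDl.
  (* The integral [U] of the weight may grow with [k], so [eta] is divided by [1 + U]; the
     right-hand side of [transport_step] is then at most [1/(k + 1)]. *)
  have eta0 : 0 < k.+1%:R^-1 / (1 + U) by rewrite divr_gt0.
  apply: (le_trans (transport_step (k1 k) (k0 k) eta0)).
  rewrite [X in (_ * X <= _)%E](_ : _ = U%:E)//.
  by rewrite -EFinM lee_fin mulrAC ler_pdivrMr// ler_wpM2l ?(ltW (k0 k))// lerDr ler01.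
have mf : measurable_fun [set: n.-tuple R] f.
  by apply/measurable_EFinP; exact: measurable_funM.
have f_f t : f_ ^~ t @ \oo --> f t.
  apply: cvg_EFin; first exact: nearW.
  pose x := row_of_tuple t.
  have cp := cvg_tpow p0 (s0 x).
  have c1 := cvg_cutoff x.
  have wc := cvg_wcut x.
  have -> : (`|d| - K * p) * s x `^ p =
      `|d| * (1 * s x `^ p) - `|0 : R| * s x `^ p - 1 * (K * (p * s x `^ p)).
    by rewrite normr0; ring.
  apply: cvgB; last by apply: cvgM => //; exact: cvg_cst.
  apply: cvgB; first by apply: cvgM; [exact: cvg_cst|exact: cvgM].
  by apply: cvgM; [exact: cvg_norm|exact: cvg_cst].
have f_B t k : (`|f_ k t| <= (B * s (row_of_tuple t) `^ p)%:E)%E.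
  by rewrite /f_ /= lee_fin g_le.
have mf_ k : measurable_fun setT (f_ k) by apply/measurable_EFinP; exact: mg.
have [_ _ cvf] := dominated_convergence measurableT mf_ mf
  (aeW _ (fun t _ => f_f t)) iB (aeW _ (fun t k _ => f_B t k)).
have If : (\int[lebesgue_tuple n]_t f t <= 0)%E.
  apply: (lee_cvg_to cvf (g := fun k => (k.+1%:R^-1)%:E)).
    by apply: cvg_EFin; [exact: nearW|exact: cvg_harmonic].
  exact: nearW.
move: If; rewrite /f; under eq_integral do rewrite EFinM.
by rewrite integralZl// pmule_rle0.
Qed.

End liouville.

(** * The Liouville principle for a finite family of functions *)

Section liouville_family.
Context {R : realType} {n : nat} {J : finType}.
Local Notation rV := 'rV[R]_n.

(** The function [s = |A|^2] formally satisfies [w.grad s = 2 A.H], which is bounded by a multiple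
    of [s]. Here [H] stands for [w.grad A], which may fail to exist: the approximants [F] are
    transported close to it. *)
Lemma transport_liouville_family (w : rV -> rV) (dw : 'I_n -> rV -> R) (d C : R)
    (A H : J -> rV -> R) (M K p1 : R) :
  (forall j, continuous (fun x => w x 0 j)) ->
  (forall j x, is_derive x (delta_mx 0 j) (fun y => w y 0 j) (dw j x)) ->
  (forall j, continuous (dw j)) ->
  (forall x, \sum_(j < n) dw j x = d) -> d != 0 ->
  (forall x, `|w x| <= C * (1 + `|x|)) ->
  (forall a, continuous (A a)) -> 0 <= M -> (forall a x, `|A a x| <= M) ->
  0 <= K -> (forall a x, `|H a x| <= K * \sum_b `|A b x|) ->
  (forall e : R, 0 < e -> exists (F : J -> rV -> R) (dF : J -> 'I_n -> rV -> R),
    [/\ forall a, continuous (F a), forall a j, continuous (dF a j),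
     forall a j x, is_derive x (delta_mx 0 j) (F a) (dF a j x) &
     forall a x, `|F a x - A a x| <= e /\
       `|\sum_(j < n) w x 0 j * dF a j x - H a x| <= e]) ->
  0 < p1 ->
  (forall p, 0 < p < p1 ->
    (\int[lebesgue_tuple n]_t ((\sum_a A a (row_of_tuple t) ^+ 2) `^ p)%:E < +oo)%E) ->
  forall a x, A a x = 0.
Proof.
move=> cw wdw cdw divw d0 wC cA M0 AM K0 HK approx p10 Aint.
pose s x : R := \sum_a A a x ^+ 2.
have s0 x : 0 <= s x by apply: sumr_ge0 => a _; exact: sqr_ge0.
suff sx : forall x, s x = 0.
  move=> a x; apply/eqP; rewrite -sqrf_eq0; apply/eqP.
  by apply: (psumr_eq0P _ (sx x)) => // b _; exact: sqr_ge0.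
pose N : R := #|J|%:R.
have N0 : 0 <= N by [].
(* The factor 2 comes from differentiating a square, [N] from Cauchy-Schwarz: the square of
   [sum |A_a|] is at most [N] times [sum A_a^2]. *)
pose K' : R := 2 * (K * N).
have K'0 : 0 <= K' by rewrite !mulr_ge0.
have cs : continuous s.
  apply: continuous_sumr => a; under eq_fun do rewrite expr2.
  by apply: continuous_mul.
have dn : 0 < `|d| by rewrite normr_gt0.
(* At most 1 for the truncated power, below [p1] for integrability, and with [K' p < |d|]; the [+ 1]
   avoids a division by zero when [K' = 0]. *)
pose p := Num.min 1 (Num.min (p1 / 2) (`|d| / (2 * (K' + 1)))).
have K'1 : 0 < 2 * (K' + 1) by lra.
have dK : 0 < `|d| / (2 * (K' + 1)) by rewrite divr_gt0.
have p0 : 0 < p by rewrite !lt_min ltr01 dK andbT divr_gt0.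
have pp1 : p < p1.
  by rewrite /p !gt_min ltr_pdivrMr// ltr_pMr// ltr1n orbT.
have p1' : p <= 1 by rewrite ge_min lexx.
have Kp : K' * p < `|d|.
  have : p <= `|d| / (2 * (K' + 1)) by rewrite !ge_min lexx !orbT.
  rewrite ler_pdivlMr//; nra.
have pint : (\int[lebesgue_tuple n]_t (s (row_of_tuple t) `^ p)%:E < +oo)%E.
  by apply: Aint; rewrite p0.
apply: (transport_liouville cw wdw cdw divw d0 wC K'0 cs s0 _ p0 p1' pint Kp) => e e0.
(* Errors per unit of [r]: the first summand for replacing [A^2] by [F^2], the second for the excess
   of [2 |F q|] over [2 |A| K S], with [S] the sum of the [|A_b|]. The terms quadratic in [r] are
   absorbed by [r <= 1]. *)
pose L : R := N * (2 * M + 1) + 2 * (N * (M + K * (N * M) + 1)).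
have L0 : 0 <= L.
  by rewrite addr_ge0// ?mulr_ge0// ?addr_ge0// ?mulr_ge0// mulr_ge0.
pose r := Num.min 1 (e / (L + 1)).
have L1 : 0 < L + 1 by lra.
have r0 : 0 < r by rewrite lt_min ltr01 divr_gt0.
have r1 : r <= 1 by rewrite ge_min lexx.
have rL : r * L <= e.
  have : r <= e / (L + 1) by rewrite ge_min lexx orbT.
  rewrite ler_pdivlMr//; nra.
have [F [dF [cF cdF FdF FP]]] := approx r r0.
pose q a x := \sum_(j < n) w x 0 j * dF a j x.
exists (fun x => \sum_a F a x ^+ 2), (fun j x => \sum_a (2 * F a x * dF a j x)).
split.
- apply: continuous_sumr => a; under eq_fun do rewrite expr2.
  exact: continuous_mul.
- move=> j; apply: continuous_sumr => a; apply: continuous_mul => //.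
  by apply: continuous_mul => //; exact: cst_continuous.
- move=> j x.
  have sumE (G : J -> rV -> R) :
      (fun x => \sum_a G a x) = (fun x => \sum_(i < #|J|) G (enum_val i) x).
    by apply/funext => y; rewrite (reindex _ (onW_bij _ (enum_val_bij J)))/=; apply: eq_bigr.
  rewrite sumE (reindex _ (onW_bij _ (enum_val_bij J)))/=.
  apply: is_derive_bigsum => i.
  under eq_fun do rewrite expr2.
  have h := FdF (enum_val i) j x.
  have := is_derive_mul h h.
  by rewrite (_ : _ + _ = 2 * F (enum_val i) x * dF (enum_val i) j x)//; ring.
- by move=> x; apply: sumr_ge0 => a _; exact: sqr_ge0.
- move=> x; have sumN (c : R) : \sum_(a : J) c = N * c.
    by rewrite sumr_const -mulr_natl.
  split.
    rewrite /s -sumrB (le_trans (ler_norm_sum _ _ _))//.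
    apply: (@le_trans _ _ (\sum_(a : J) r * (2 * M + 1))).
      apply: ler_sum => a _; have [h _] := FP a x; have h2 := AM a x.
      rewrite subr_sqr normrM ler_pM//.
      rewrite (_ : F a x + A a x = F a x - A a x + 2 * A a x); last by ring.
      rewrite (le_trans (ler_normD _ _))// normrM ger0_norm//; lra.
    rewrite sumN (le_trans _ rL)// mulrCA ler_wpM2l ?(ltW r0)// /L lerDl.
    by rewrite !mulr_ge0// ?addr_ge0// ?mulr_ge0// mulr_ge0.
  have -> : \sum_(j < n) w x 0 j * (\sum_a 2 * F a x * dF a j x) =
      \sum_a 2 * (F a x * q a x).
    under eq_bigr do rewrite mulr_sumr; rewrite exchange_big/=; apply: eq_bigr => a _.
    by rewrite /q !mulr_sumr; apply: eq_bigr => j _; ring.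
  rewrite (le_trans (ler_norm_sum _ _ _))//.
  pose S := \sum_b `|A b x|.
  have SM : S <= N * M by rewrite -sumN; apply: ler_sum.
  have S0 : 0 <= S by apply: sumr_ge0.
  apply: (@le_trans _ _ (\sum_a (2 * (`|A a x| * (K * S)) + r * (2 * (M + K * (N * M) + 1))))).
    apply: ler_sum => a _; have [h1 h2] := FP a x; have h3 := AM a x; have h4 := HK a x.
    have f1 : `|F a x| <= `|A a x| + r.
      by rewrite -lerBlDl (le_trans _ h1)// lerB_dist.
    have q1 : `|q a x| <= K * S + r.
      by rewrite (le_trans _ (lerD h4 (lexx r)))// -lerBlDl (le_trans _ h2)// lerB_dist.
    rewrite !normrM ger0_norm//.
    have := ler_pM (normr_ge0 _) (normr_ge0 _) f1 q1.
    have KS : K * S <= K * (N * M) by rewrite ler_wpM2l.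
    have KS0 : 0 <= K * S by rewrite mulr_ge0.
    nra.
  rewrite big_split/= sumN lerD//; last first.
    rewrite (_ : N * _ = r * (2 * (N * (M + K * (N * M) + 1)))); last by ring.
    rewrite (le_trans _ rL)// ler_wpM2l ?(ltW r0)// /L lerDr.
    by rewrite mulr_ge0// addr_ge0// mulr_ge0.
  rewrite -mulr_sumr -mulr_suml -/S /K' -!mulrA ler_wpM2l//.
  rewrite mulrCA ler_wpM2l//.
  have -> : S * S = \sum_a \sum_b `|A a x| * `|A b x|.
    by rewrite {1}/S mulr_suml; apply: eq_bigr => a _; rewrite mulr_sumr.
  apply: (@le_trans _ _ (\sum_a \sum_b (2^-1 * A a x ^+ 2 + 2^-1 * A b x ^+ 2))).
    apply: ler_sum => a _; apply: ler_sum => b _.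
    rewrite -[A a x ^+ 2]real_normK ?num_real// -[A b x ^+ 2]real_normK ?num_real//.
    have := sqr_ge0 (`|A a x| - `|A b x|); rewrite sqrrB; lra.
  under eq_bigr do rewrite big_split/= sumN -mulr_sumr -/(s x).
  rewrite big_split/= sumN -!mulr_sumr -/(s x); lra.
Qed.

End liouville_family.
(** * Circulations along small squares *)

Definition ucont (R : realType) (E : normedModType R) (f : E -> R) :=
  forall e : R, 0 < e ->
  exists2 r : R, 0 < r & forall x y : E, `|x - y| < r -> `|f x - f y| <= e.

Lemma ucont_continuous (R : realType) (E : normedModType R) (f : E -> R) :
  ucont f -> continuous f.
Proof.
move=> fu x; apply/cvgrPdist_le => e e0; have [r r0 H] := fu e e0.
near=> y; apply: H; near: y; exact: cvgr_dist_lt.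
Unshelve. all: by end_near. Qed.

Section uniform.
Context {R : realType} {n : nat}.
Local Notation rV := 'rV[R]_n.
Implicit Types f g : rV -> R.

Lemma vanishing_bounded f : continuous f -> vanishes_at_infinity f ->
  exists2 K : R, 0 <= K & forall x, `|f x| <= K.
Proof.
move=> cf vf; have [M HM] := vf 1 ltr01.
have [K [K0 HK]] := continuous_bounded_ball M cf.
exists (K + 1) => [|x]; first by rewrite addr_ge0.
have [/HK xK|/HM/ltW x1] := leP `|x| M; first by rewrite (le_trans xK)// lerDl.
by rewrite (le_trans x1)// lerDr.
Qed.

(** On a large ball compactness gives the modulus of continuity; far away both values are below
    [e/2]. *)
Lemma vanishing_ucont f : continuous f -> vanishes_at_infinity f -> ucont f.
Proof.
move=> cf vf e e0; have e20 : 0 < e / 2 by rewrite divr_gt0.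
have [M HM] := vf _ e20.
have cB : compact [set x : rV | `|x| <= M + 1] by exact: compact_norm_le.
have [r /= r0 rP] : \forall r \near (0 : R)^'+, forall x, [set x : rV | `|x| <= M + 1] x ->
    forall y, `|x - y| < r -> `|f x - f y| <= e.
  move/compact_near_coveringP : cB; apply => x _.
  have /cvgrPdist_lt/(_ _ e20)/nbhs_ballP[d /= d0 dP] := cf x.
  have d20 : 0 < d / 2 by rewrite divr_gt0.
  near=> z r => y zy /=.
  have xz : `|x - z| < d / 2 by near: z; exact: cvgr_dist_lt.
  have rd : r < d / 2 by near: r; exact: nbhs_right_lt.
  have h1 : `|f x - f z| < e / 2.
    by apply: dP; rewrite -ball_normE /ball_/= (lt_trans xz)// ltr_pdivrMr// ltr_pMr// ltr1n.
  have h2 : `|f x - f y| < e / 2.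
    apply: dP; rewrite -ball_normE /ball_/= (_ : x - y = x - z + (z - y)).
      by rewrite (le_lt_trans (ler_normD _ _))// [d]splitr ltrD// (lt_trans zy).
    by rewrite addrA subrK.
  rewrite (_ : f z - f y = (f x - f y) - (f x - f z)); last by ring.
  by rewrite (le_trans (ler_normB _ _))// [e]splitr lerD// ltW.
(* The cap at 1 keeps [y] outside the ball of radius [M] when [x] is outside the ball of radius
   [M + 1]. *)
pose r' := Num.min (r / 2) 1.
have r'0 : 0 < r' by rewrite lt_min divr_gt0//=.
exists r' => // x y xy; have [xM|xM] := leP `|x| (M + 1).
  apply: (rP r' _ r'0 x xM y xy).
  rewrite /ball_/= sub0r normrN gtr0_norm// gt_min; apply/orP; left.
  by rewrite ltr_pdivrMr// ltr_pMr// ltr1n.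
have fx : `|f x| < e / 2 by apply: HM; rewrite (lt_trans _ xM)// ltrDl.
have fy : `|f y| < e / 2.
  apply: HM; rewrite -(ltrD2r 1) (lt_le_trans xM)//.
  rewrite -lerBlDl (le_trans (lerB_dist _ _))// (le_trans (ltW xy))//.
  by rewrite ge_min lexx orbT.
by rewrite (le_trans (ler_normB _ _))// [e]splitr lerD// ltW.
Unshelve. all: by end_near. Qed.

End uniform.

(** * Averages over the unit interval and over segments *)

Section mean.
Context {R : realType}.
Implicit Types g h : R -> R.

Definition mean (g : R -> R) : R :=
  \int[@lebesgue_measure R]_(s in `[0, 1]%classic) g s.

Let integrable01 g : continuous g ->
  (@lebesgue_measure R).-integrable `[0, 1]%classic (EFin \o g).
Proof.
move=> cg; apply: continuous_compact_integrable; first exact: segment_compact.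
exact: continuous_subspaceT.
Qed.

Lemma meanD g h : continuous g -> continuous h ->
  mean (fun s => g s + h s) = mean g + mean h.
Proof. by move=> cg ch; rewrite /mean RintegralD//; exact: integrable01. Qed.

Lemma meanZ (c : R) g : continuous g -> mean (fun s => c * g s) = c * mean g.
Proof. by move=> cg; rewrite /mean RintegralZl//; exact: integrable01. Qed.

Lemma meanN g : continuous g -> mean (fun s => - g s) = - mean g.
Proof.
move=> cg; rewrite -mulN1r -meanZ//; congr mean.
by apply/funext => s; rewrite mulN1r.
Qed.

Lemma meanB g h : continuous g -> continuous h ->
  mean (fun s => g s - h s) = mean g - mean h.
Proof. by move=> cg ch; rewrite meanD ?meanN//; exact: continuous_opp. Qed.

Lemma mean_cst (c : R) : mean (fun=> c) = c.
Proof.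
rewrite /mean Rintegral_cst//= lebesgue_measure_itv/= lte_fin ltr01.
by rewrite oppr0 adde0 mulr1.
Qed.

Lemma mean_sum (I : Type) (r : seq I) (f : I -> R -> R) :
  (forall i, continuous (f i)) ->
  mean (fun s => \sum_(i <- r) f i s) = \sum_(i <- r) mean (f i).
Proof.
move=> cf; elim: r => [|i r IH].
  by rewrite big_nil; under eq_fun do rewrite big_nil; exact: mean_cst.
rewrite big_cons -IH -meanD//; last exact: continuous_sumr.
by congr mean; apply/funext => s; rewrite big_cons.
Qed.

Lemma mean_dist_le g (c e : R) : continuous g ->
  (forall s, 0 <= s <= 1 -> `|g s - c| <= e) -> `|mean g - c| <= e.
Proof.
move=> cg gc; rewrite -[c in mean g - c]mean_cst -meanB//; last exact: cst_continuous.
have cgc : continuous (fun s => g s - c).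
  by apply: continuous_add => //; exact: cst_continuous.
rewrite /mean (le_trans (le_normr_Rintegral _ _))//; first exact: integrable01.
rewrite -[leRHS]mean_cst; apply: le_Rintegral => //.
- by apply: integrable01; exact: continuous_norm.
- by apply: integrable01; exact: cst_continuous.
Qed.

Lemma mean_derive (G g : R -> R) : continuous g ->
  (forall s, is_derive s (1 : R) G (g s)) -> mean g = G 1 - G 0.
Proof.
move=> cg Gg.
have cG : continuous G.
  move=> x; apply: differentiable_continuous; apply/derivable1_diffP.
  by have [] := Gg x.
rewrite /mean /Rintegral (@continuous_FTC2 _ g G 0 1) ?ltr01//.
- exact: continuous_subspaceT.
- split.
  + by move=> x _; have [] := Gg x.
  + by apply: cvg_at_right_filter; exact: cG.
  + by apply: cvg_at_left_filter; exact: cG.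
- by move=> x _; rewrite derive1E; have [_ ->] := Gg x.
Qed.

End mean.
Section segments.
Context {R : realType} {n : nat}.
Local Notation rV := 'rV[R]_n.
Implicit Types (f df : rV -> R) (u v x y z : rV).

Lemma continuous_line u y : continuous (fun s : R => s *: u + y).
Proof.
apply: (@lipschitz_continuous_map R R^o rV _ `|u|) => s t.
by rewrite opprD addrACA subrr addr0 -scalerBl normrZ mulrC.
Qed.

Lemma continuous_on_line f u y : continuous f -> continuous (fun s : R => f (s *: u + y)).
Proof.
move=> cf s; apply: (@continuous_comp _ _ _ (fun s : R => s *: u + y) f).
  exact: continuous_line.
exact: cf.
Qed.

Lemma is_derive_on_line f df v z (t : R) : (forall x, is_derive x v f (df x)) ->
  is_derive t (1 : R) (fun t : R => f (t *: v + z)) (df (t *: v + z)).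
Proof.
move=> fdf; apply/is_derive_lineP; have /is_derive_lineP := fdf (t *: v + z).
rewrite (_ : (fun h : R => f (h *: v + (t *: v + z))) =
  (fun h : R => f ((h *: (1 : R) + t) *: v + z)))//.
by apply/funext => h; rewrite addrA -scalerDl scaler1.
Qed.

(** Mean value theorem on a segment. The bound depends only on how far [df] is from [c], so it
    becomes uniform in [z] once [df] is uniformly continuous. *)
Lemma increment_approx f df v z (c e h : R) : (forall x, is_derive x v f (df x)) ->
  (forall t : R, `|t| <= `|h| -> `|df (t *: v + z) - c| <= e) ->
  `|f (h *: v + z) - f z - h * c| <= e * `|h|.
Proof.
move=> fdf dfc; pose g (t : R) := f (t *: v + z).
have gdf t : is_derive t (1 : R) g (df (t *: v + z)) by exact: is_derive_on_line.
have cg : continuous g.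
  move=> x; apply: differentiable_continuous; apply/derivable1_diffP.
  by have [] := gdf x.
have g0 : g 0 = f z by rewrite /g scale0r add0r.
have [t th gt] : exists2 t : R, `|t| <= `|h| & g h - g 0 = df (t *: v + z) * h.
  have [h0|h0] := leP 0 h.
    have [|t] := @MVT_segment R g (fun t => df (t *: v + z)) 0 h h0 (fun t _ => gdf t).
      exact: continuous_subspaceT.
    rewrite in_itv/= => /andP[t0 th] E; exists t; first by rewrite !ger0_norm.
    by rewrite E subr0.
  have [|t] := @MVT_segment R g (fun t => df (t *: v + z)) h 0 (ltW h0) (fun t _ => gdf t).
    exact: continuous_subspaceT.
  rewrite in_itv/= => /andP[ht t0] E; exists t.
    by rewrite (ler0_norm t0) (ler0_norm (ltW h0)) lerN2.
  by rewrite -opprB E sub0r mulrN opprK.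
rewrite -g0 gt mulrC -mulrBr normrM mulrC ler_wpM2r//; exact: dfc.
Qed.

Definition segment_mean f u y : R := mean (fun s => f (s *: u + y)).

Lemma ucont_segment_mean f u : ucont f -> ucont (segment_mean f u).
Proof.
move=> uf e e0; have [r r0 H] := uf e e0; have cf := ucont_continuous uf.
exists r => // x y xy; rewrite /segment_mean -meanB; [|exact: continuous_on_line..].
rewrite -[X in `|X|]subr0; apply: mean_dist_le => [|s _].
  apply: continuous_add; last apply: continuous_opp; exact: continuous_on_line.
rewrite subr0; apply: H; rewrite (_ : _ - _ = x - y)//.
by rewrite opprD addrACA subrr add0r.
Qed.

(** Differentiation under the integral sign: uniform continuity of [df] makes the remainder small
    uniformly along the segment. *)
Lemma is_derive_segment_mean f df u v : continuous f ->
  (forall x, is_derive x v f (df x)) -> ucont df ->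
  forall y, is_derive y v (segment_mean f u) (segment_mean df u y).
Proof.
move=> cf fdf udf y; have cdf := ucont_continuous udf.
apply: is_derive_approx => e e0; have [r r0 H] := udf e e0.
have v1 : 0 < `|v| + 1 by rewrite ltr_wpDl.
exists (r / (`|v| + 1)); first by rewrite divr_gt0.
move=> h hr; rewrite /segment_mean -meanB; [|exact: continuous_on_line..].
rewrite -meanZ; last exact: continuous_on_line.
have c1 : continuous (fun s : R => f (s *: u + (h *: v + y)) - f (s *: u + y)).
  apply: continuous_add; last apply: continuous_opp; exact: continuous_on_line.
have c2 : continuous (fun s : R => h * df (s *: u + y)).
  by apply: continuous_mul; [exact: cst_continuous|exact: continuous_on_line].
rewrite -meanB// -[X in `|X|]subr0; apply: mean_dist_le => [|s _].
  by apply: continuous_add => //; exact: continuous_opp.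
rewrite subr0 addrCA; apply: (increment_approx fdf) => t th; apply: H.
rewrite addrK normrZ (le_lt_trans (ler_wpM2r (normr_ge0 _) th))//.
apply: (@le_lt_trans _ _ (`|h| * (`|v| + 1))); first by rewrite ler_wpM2l// lerDl.
by rewrite -ltr_pdivlMr.
Qed.

Lemma segment_mean_derive f df u y : (forall x, is_derive x u f (df x)) ->
  continuous df -> segment_mean df u y = f (u + y) - f y.
Proof.
move=> fdf cdf.
have H1 : continuous (fun s : R => df (s *: u + y)) by exact: continuous_on_line.
have H2 (t : R) : is_derive t (1 : R) (fun t : R => f (t *: u + y)) (df (t *: u + y)).
  exact: is_derive_on_line.
by rewrite /segment_mean (mean_derive H1 H2) scale1r scale0r add0r.
Qed.

Lemma is_deriveZ_dir f x v d (h : R) : is_derive x v f d -> is_derive x (h *: v) f (h * d).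
Proof.
move=> /is_derive_lineP fd; apply/is_derive_lineP.
pose g (t : R) := f (t *: v + x).
rewrite (_ : (fun t : R => f (t *: (h *: v) + x)) = g \o (fun t : R => t * h)); last first.
  by apply/funext => t; rewrite /g /= scalerA.
rewrite mulrC; apply: is_derive1_comp; first by rewrite mul0r.
have := is_derive_mul (is_derive_id (0 : R) (1 : R)) (is_derive_cst h (0 : R) (1 : R)).
by rewrite mulr0 addr0 mul1r.
Qed.

End segments.
Section circulation.
Context {R : realType} {n : nat}.
Local Notation rV := 'rV[R]_n.
Local Notation "''E_' i" := (delta_mx 0 i : rV) (at level 8, i at level 2).
Implicit Types (X Y : 'I_n -> rV -> R) (x y z : rV) (i j k : 'I_n) (h : R).

Lemma norm_delta_row i : `|'E_i| <= 1.
Proof.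
apply: ler_norm_coord => // k; rewrite mxE eqxx /=.
by case: eqP => _; rewrite ?normr1 ?normr0.
Qed.

(** Line integral of the 1-form [X] around the square with corner [y] and sides [h E_i], [h E_j],
    divided by the area [h^2]: each mean already contains one factor [1/h]. For C^1 forms it is the
    average of [d_i X_j - d_j X_i] over the square; it makes sense for continuous [X]. *)
Definition circulation X i j h y : R :=
  h^-1 * (segment_mean (X i) (h *: 'E_i) y -
          segment_mean (X i) (h *: 'E_i) (h *: 'E_j + y) +
          segment_mean (X j) (h *: 'E_j) (h *: 'E_i + y) -
          segment_mean (X j) (h *: 'E_j) y).

Lemma segment_mean_sum (I : Type) (r : seq I) (f : I -> rV -> R) u y :
  (forall a, continuous (f a)) ->
  segment_mean (fun x => \sum_(a <- r) f a x) u y = \sum_(a <- r) segment_mean (f a) u y.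
Proof.
by move=> cf; rewrite /segment_mean mean_sum// => a; exact: continuous_on_line.
Qed.

Lemma segment_meanD (f g : rV -> R) u y : continuous f -> continuous g ->
  segment_mean (fun x => f x + g x) u y = segment_mean f u y + segment_mean g u y.
Proof.
by move=> cf cg; rewrite /segment_mean meanD//; exact: continuous_on_line.
Qed.

Lemma segment_meanZ (c : R) (f : rV -> R) u y : continuous f ->
  segment_mean (fun x => c * f x) u y = c * segment_mean f u y.
Proof.
by move=> cf; rewrite /segment_mean meanZ//; exact: continuous_on_line.
Qed.

Lemma circulationD X Y i j h y : (forall l, continuous (X l)) ->
  (forall l, continuous (Y l)) ->
  circulation (fun l x => X l x + Y l x) i j h y =
  circulation X i j h y + circulation Y i j h y.
Proof.
move=> cX cY; rewrite /circulation !segment_meanD//.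
have E (c a a' b b' p p' q q' : R) : c * (a + a' - (b + b') + (p + p') - (q + q')) =
  c * (a - b + p - q) + c * (a' - b' + p' - q') by ring.
exact: E.
Qed.

Lemma circulationZ (c : R) X i j h y : (forall l, continuous (X l)) ->
  circulation (fun l x => c * X l x) i j h y = c * circulation X i j h y.
Proof.
move=> cX; rewrite /circulation !segment_meanZ//.
have E (t a b p q : R) : t * (c * a - c * b + c * p - c * q) =
  c * (t * (a - b + p - q)) by ring.
exact: E.
Qed.

Lemma circulation_sum (I : Type) (r : seq I) (X : I -> 'I_n -> rV -> R) i j h y :
  (forall a l, continuous (X a l)) ->
  circulation (fun l x => \sum_(a <- r) X a l x) i j h y =
  \sum_(a <- r) circulation (X a) i j h y.
Proof.
move=> cX; rewrite /circulation !segment_mean_sum//.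
by rewrite -mulr_sumr !sumrB !big_split/= !sumrN.
Qed.

(** Each side contributes a difference of [Q] at two corners, and these cancel around the square. *)
Lemma circulation_gradient (Q : rV -> R) X i j h y : h != 0 ->
  (forall l, continuous (X l)) ->
  (forall l x, is_derive x 'E_l Q (X l x)) -> circulation X i j h y = 0.
Proof.
move=> h0 cX QX.
have seg l z : segment_mean (X l) (h *: 'E_l) z = h^-1 * (Q (h *: 'E_l + z) - Q z).
  have H1 x : is_derive x (h *: 'E_l) Q (h * X l x) by exact: is_deriveZ_dir.
  have H2 : continuous (fun x => h * X l x).
    by apply: continuous_mul => //; exact: cst_continuous.
  rewrite -(@segment_mean_derive _ _ Q (fun x => h * X l x) _ z H1 H2).
  by rewrite segment_meanZ// mulKf.
rewrite /circulation !seg (addrCA (h *: 'E_i)).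
have E (c a b p q : R) : c * (c * (a - b) - c * (p - q) + c * (p - a) - c * (q - b)) = 0.
  by ring.
exact: E.
Qed.

(** The derivative falls on the form. This is what makes the averaged curl C^1 where the curl itself
    is only continuous. *)
Lemma is_derive_circulation X (dX : 'I_n -> 'I_n -> rV -> R) i j h :
  (forall l, continuous (X l)) -> (forall k l, ucont (dX k l)) ->
  (forall k l x, is_derive x 'E_k (X l) (dX k l x)) ->
  forall k y, is_derive y 'E_k (circulation X i j h) (circulation (dX k) i j h y).
Proof.
move=> cX udX XdX k y.
have seg l u z : is_derive z 'E_k (segment_mean (X l) u) (segment_mean (dX k l) u z).
  exact: (is_derive_segment_mean u (cX l) (XdX k l) (udX k l)).
have shift l u z : is_derive y 'E_k (fun y => segment_mean (X l) u (z + y))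
    (segment_mean (dX k l) u (z + y)).
  apply/is_derive_lineP; have /is_derive_lineP := seg l u (z + y).
  by under [X in is_derive _ _ X]eq_fun do rewrite addrCA.
have h1 := is_deriveB (is_deriveD (is_deriveB (seg i (h *: 'E_i) y)
  (shift i (h *: 'E_i) (h *: 'E_j))) (shift j (h *: 'E_j) (h *: 'E_i)))
  (seg j (h *: 'E_j) y).
by have := is_derive_mul (is_derive_cst h^-1 y 'E_k) h1; rewrite mul0r add0r.
Qed.

Lemma continuous_circulation X i j h : (forall l, ucont (X l)) ->
  continuous (circulation X i j h).
Proof.
move=> uX; have cs l u : continuous (segment_mean (X l) u).
  by apply: ucont_continuous; exact: ucont_segment_mean.
have ct l u z : continuous (fun y => segment_mean (X l) u (z + y)).
  apply: ucont_continuous => e e0.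
  have [r r0 H] := ucont_segment_mean u (uX l) e0.
  by exists r => // x y xy; apply: H; rewrite opprD addrACA subrr add0r.
apply: continuous_mul; first exact: cst_continuous.
apply: continuous_add; last exact: continuous_opp.
apply: continuous_add => //.
by apply: continuous_add => //; exact: continuous_opp.
Qed.

(** Opposite sides are paired: the circulation is the mean of the difference quotients of [X j] in
    direction [i] minus that of [X i] in direction [j], and the two errors add up. *)
Lemma circulation_approx X i j h y (a b e : R) : (forall l, continuous (X l)) ->
  (forall s : R, 0 <= s <= 1 -> forall z, z = s *: (h *: 'E_i) + y ->
    `|h^-1 * (X i (h *: 'E_j + z) - X i z) - a| <= e) ->
  (forall s : R, 0 <= s <= 1 -> forall z, z = s *: (h *: 'E_j) + y ->
    `|h^-1 * (X j (h *: 'E_i + z) - X j z) - b| <= e) ->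
  `|circulation X i j h y - (b - a)| <= 2 * e.
Proof.
move=> cX Xa Xb.
have cl l u z : continuous (fun s : R => X l (s *: u + z)) by exact: continuous_on_line.
have H l u v c : (forall s : R, 0 <= s <= 1 -> forall z, z = s *: u + y ->
    `|h^-1 * (X l (v + z) - X l z) - c| <= e) ->
    `|h^-1 * (segment_mean (X l) u (v + y) - segment_mean (X l) u y) - c| <= e.
  move=> Xc; rewrite /segment_mean -meanB// -meanZ; last first.
    by apply: continuous_add => //; exact: continuous_opp.
  apply: mean_dist_le => [|s s01].
    apply: continuous_mul; first exact: cst_continuous.
    by apply: continuous_add => //; exact: continuous_opp.
  by rewrite addrCA; exact: (Xc s s01 _ erefl).
have := H _ _ _ _ Xa; have := H _ _ _ _ Xb; rewrite /circulation.
set p := segment_mean _ _ (_ + _); set q := segment_mean _ _ y.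
set p' := segment_mean _ _ (_ + _); set q' := segment_mean _ _ y.
move=> h1 h2.
rewrite (_ : _ - (b - a) = (h^-1 * (p - q) - b) - (h^-1 * (p' - q') - a)); last by ring.
by rewrite (le_trans (ler_normB _ _))// mulr_natl mulr2n lerD.
Qed.

(** Approximates the derivative of [(f - f y) g] at [y] for a [g] that is only uniformly continuous:
    [f - f y] is of order [h] on the square, so after division by [h] the small increment of [g] is
    multiplied by a bounded quantity. The radius is uniform in [y]. *)
Lemma increment_mul_approx (f g : rV -> R) (df : 'I_n -> rV -> R) (L M : R) :
  (forall l x, is_derive x 'E_l f (df l x)) -> (forall l, ucont (df l)) ->
  0 <= L -> (forall l x, `|df l x| <= L) -> ucont g -> (forall x, `|g x| <= M) ->
  forall e, 0 < e -> exists2 r : R, 0 < r & forall h, 0 < h < r ->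
    forall i j (s : R) y z, 0 <= s <= 1 -> z = s *: (h *: 'E_i) + y ->
    `|h^-1 * ((f (h *: 'E_j + z) - f y) * g (h *: 'E_j + z) - (f z - f y) * g z)
      - df j y * g y| <= e.
Proof.
move=> fdf udf L0 dfL ug gM e e0.
have M0 : 0 <= M by rewrite (le_trans _ (gM 0)).
(* Three errors will appear, bounded by [M e1], [L e1] and [L e1]; the [+ 1] keeps [D] positive. *)
pose D := M + L + L + 1.
have D0 : 0 < D by rewrite /D; lra.
pose e1 := e / D.
have e10 : 0 < e1 by rewrite divr_gt0.
have udf' : exists2 r : R, 0 < r &
    forall l (x y : rV), `|x - y| < r -> `|df l x - df l y| <= e1.
  have /choice[r rP] : forall l, exists r : R, 0 < r /\
      forall (x y : rV), `|x - y| < r -> `|df l x - df l y| <= e1.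
    by move=> l; have [r r0 H] := udf l e1 e10; exists r.
  exists (\big[Num.min/1]_l r l).
    apply: (big_ind (fun x : R => 0 < x)) => //.
      by move=> x y x0 y0; rewrite lt_min x0.
    by move=> l _; have [] := rP l.
  move=> l x y xy; apply: (rP l).2; apply: (lt_le_trans xy).
  exact: bigmin_le_cond.
have [r1 r10 H1] := udf'.
have [r2 r20 H2] := ug e1 e10.
(* The points involved are within [2 h] of [y], hence the halved radii. *)
exists (Num.min (r1 / 2) (r2 / 2)); first by rewrite lt_min !divr_gt0.
move=> h /andP[h0]; rewrite lt_min => /andP[hr1 hr2] i j s y z /andP[s0 s1] zE.
have hz l (t : R) : `|t| <= h -> `|t *: 'E_l| <= h.
  by move=> th; rewrite normrZ -[leRHS]mulr1 ler_pM// norm_delta_row.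
have zy : `|z - y| <= h.
  rewrite zE addrK scalerA; apply: hz.
  by rewrite ger0_norm ?mulr_ge0 ?(ltW h0)// ler_piMl// ltW.
have far (t : R) l : `|t| <= h -> `|t *: 'E_l + z - y| <= 2 * h.
  move=> th; rewrite -addrA (le_trans (ler_normD _ _))// mulr_natl mulr2n lerD//.
  exact: hz.
have hh : `|h| = h by rewrite gtr0_norm.
have a1 : `|f (h *: 'E_j + z) - f z - h * df j y| <= e1 * h.
  rewrite -[X in _ <= _ * X]hh; apply: (increment_approx (fdf j)) => t.
  rewrite hh => th; apply: H1.
  by rewrite (le_lt_trans (far _ _ th))// mulrC -ltr_pdivlMr.
have a2 : `|f z - f y| <= L * h.
  have := @increment_approx _ _ f (df i) 'E_i y 0 L (s * h) (fdf i).
  rewrite mulr0 subr0 -scalerA -zE => H.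
  rewrite (le_trans (H _))//; first by move=> t _; rewrite subr0.
  by rewrite ler_wpM2l// ger0_norm ?mulr_ge0 ?(ltW h0)// ler_piMl// ltW.
have g1 : `|g (h *: 'E_j + z) - g y| <= e1.
  by apply: H2; rewrite (le_lt_trans (far h j _))// ?hh// mulrC -ltr_pdivlMr.
have g2 : `|g (h *: 'E_j + z) - g z| <= e1.
  apply: H2; rewrite addrK (le_lt_trans (hz j h _)) ?hh//.
  by rewrite (lt_trans hr2)// ltr_pdivrMr// ltr_pMr// ltr1n.
set F := f (h *: 'E_j + z) - f z in a1.
set G := g (h *: 'E_j + z).
(* The three terms are the first-order remainder of [f], the displacement of [g] against [df], and
   the increment of [g] against [f z - f y], which is at most [L h]. *)
rewrite (_ : _ - df j y * g y = h^-1 * (F - h * df j y) * G + df j y * (G - g y) +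
   h^-1 * (f z - f y) * (G - g z)); last by rewrite /F; field; rewrite gt_eqF.
have GM : `|G| <= M by exact: gM.
have hi : 0 < h^-1 by rewrite invr_gt0.
have b1 : `|h^-1 * (F - h * df j y) * G| <= e1 * M.
  rewrite !normrM ler_pM// (gtr0_norm hi) mulrC ler_pdivrMr//.
have b2 : `|df j y * (G - g y)| <= L * e1 by rewrite normrM ler_pM.
have b3 : `|h^-1 * (f z - f y) * (G - g z)| <= L * e1.
  by rewrite !normrM ler_pM// (gtr0_norm hi) mulrC ler_pdivrMr.
have eE : e = e1 * D by rewrite /e1 divfK// gt_eqF.
rewrite eE /D (le_trans (ler_normD _ _))//.
have := ler_normD (h^-1 * (F - h * df j y) * G) (df j y * (G - g y)).
lra.
Qed.

End circulation.

(** * Vanishing of the vorticity for the stationary momentum equation *)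

Lemma fin_radius (R : realType) (I : finType) (P : I -> R -> Prop) :
  (forall i, exists2 r : R, 0 < r & forall h, 0 < h < r -> P i h) ->
  exists2 r : R, 0 < r & forall h, 0 < h < r -> forall i, P i h.
Proof.
move=> HP.
have /choice[r rP] : forall i, exists r : R, 0 < r /\ forall h, 0 < h < r -> P i h.
  by move=> i; have [r r0 H] := HP i; exists r.
exists (\big[Num.min/1]_i r i).
  apply: (big_ind (fun x : R => 0 < x)) => //.
    by move=> x y x0 y0; rewrite lt_min x0.
  by move=> i _; have [] := rP i.
move=> h /andP[h0 hr] i; apply: (rP i).2; rewrite h0/=; apply: (lt_le_trans hr).
exact: bigmin_le_cond.
Qed.

(* b and w are as in the header and a = alpha b. *)
Section steady_vorticity.
Context {R : realType} {n : nat}.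
Local Notation rV := 'rV[R]_n.
Local Notation "''E_' i" := (delta_mx 0 i : rV) (at level 8, i at level 2).
Variables (V : 'I_n -> rV -> R) (dV : 'I_n -> 'I_n -> rV -> R).
Variables (P : rV -> R) (dP : 'I_n -> rV -> R) (a b L M p1 : R).
Hypothesis VdV : forall j i x, is_derive x 'E_j (V i) (dV j i x).
Hypothesis uV : forall i, ucont (V i).
Hypothesis VM : forall i x, `|V i x| <= M.
Hypothesis M0 : 0 <= M.
Hypothesis udV : forall j i, ucont (dV j i).
Hypothesis L0 : 0 <= L.
Hypothesis dVL : forall j i x, `|dV j i x| <= L.
Hypothesis divV : forall x, \sum_(j < n) dV j j x = 0.
Hypothesis b0 : b != 0.
Hypothesis n0 : (0 < n)%N.
Hypothesis PdP : forall i x, is_derive x 'E_i P (dP i x).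
Hypothesis eqV : forall i x,
  a * V i x + \sum_(k < n) (V k x + b * x 0 k) * dV k i x = - dP i x.

Let A (i j : 'I_n) (x : rV) : R := dV i j x - dV j i x.
Let w (k : 'I_n) (x : rV) : R := V k x + b * x 0 k.
Let dw (j k : 'I_n) (x : rV) : R := dV j k x + b * (j == k)%:R.
Let c : R := a - b.

Hypothesis p10 : 0 < p1.
Hypothesis A_int : forall p, 0 < p < p1 ->
  (\int[lebesgue_tuple n]_t
    ((\sum_(ij : 'I_n * 'I_n) A ij.1 ij.2 (row_of_tuple t) ^+ 2) `^ p)%:E < +oo)%E.

Let cV i : continuous (V i). Proof. exact: ucont_continuous. Qed.
Let cdV j i : continuous (dV j i). Proof. exact: ucont_continuous. Qed.

Let uA i j : ucont (A i j).
Proof.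
move=> e e0; have e20 : 0 < e / 2 by rewrite divr_gt0.
have [r1 r10 H1] := udV i j e20; have [r2 r20 H2] := udV j i e20.
exists (Num.min r1 r2); first by rewrite lt_min r10.
move=> x y; rewrite lt_min => /andP[/H1 h1 /H2 h2].
rewrite /A (_ : _ - _ = (dV i j x - dV i j y) - (dV j i x - dV j i y)); last by ring.
by rewrite (le_trans (ler_normB _ _))// [e]splitr lerD.
Qed.

Let cA i j : continuous (A i j). Proof. exact: ucont_continuous. Qed.

Let AL i j x : `|A i j x| <= 2 * L.
Proof. by rewrite /A (le_trans (ler_normB _ _))// mulr_natl mulr2n lerD. Qed.

Let wdw j k x : is_derive x 'E_j (w k) (dw j k x).
Proof.
have h := is_derive_mul (is_derive_cst b x 'E_j) (is_derive_coord x 'E_j k).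
have := is_deriveD (VdV j k x) h.
by rewrite mul0r add0r mxE eqxx/= [k == j]eq_sym.
Qed.

Let udw j k : ucont (dw j k).
Proof.
move=> e e0; have [r r0 H] := udV j k e0; exists r => // x y /H.
by rewrite /dw opprD addrACA subrr addr0.
Qed.

Let dwL j k x : `|dw j k x| <= L + `|b|.
Proof.
rewrite /dw (le_trans (ler_normD _ _))// lerD// normrM.
by case: eqP => _; rewrite ?normr1 ?mulr1// normr0 mulr0.
Qed.

Let cw k : continuous (w k).
Proof.
apply: continuous_add => //; apply: continuous_mul; first exact: cst_continuous.
exact: continuous_coord.
Qed.

(* With w = V + b x, the equation says that (a - b) V + i_w dV is a gradient,
   by Cartan's formula w . grad V = i_w dV + grad (|V|^2 / 2 + b x . V) - b V. *)
Let gradQ : exists Q : rV -> R, forall l x,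
  is_derive x 'E_l Q (c * V l x + \sum_(k < n) w k x * A k l x).
Proof.
exists (fun x => - P x - \sum_(k < n) (2^-1 * (V k x * V k x) + b * (x 0 k * V k x))).
move=> l x.
have h k : is_derive x 'E_l (fun x => 2^-1 * (V k x * V k x) + b * (x 0 k * V k x))
    (w k x * dV l k x + b * ((l == k)%:R * V k x)).
  have h1 := is_derive_mul (is_derive_cst (2^-1 : R) x 'E_l)
    (is_derive_mul (VdV l k x) (VdV l k x)).
  have h2 := is_derive_mul (is_derive_cst b x 'E_l)
    (is_derive_mul (is_derive_coord x 'E_l k) (VdV l k x)).
  apply: is_derive_eq (is_deriveD h1 h2) _.
  by rewrite mxE eqxx/= [k == l]eq_sym /w /cst; field.
have := is_deriveB (is_deriveN (PdP l x)) (is_derive_bigsum h).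
rewrite (_ : - dP l x - _ = c * V l x + \sum_(k < n) w k x * A k l x)//.
have VE : \sum_(k < n) (l == k)%:R * V k x = V l x.
  rewrite (bigD1 l)//= eqxx mul1r big1 ?addr0// => k kl.
  by rewrite eq_sym (negbTE kl) mul0r.
rewrite -eqV big_split/= -mulr_sumr VE.
under [in RHS]eq_bigr do rewrite /A mulrBr.
rewrite sumrB /c /w.
have E (s t v : R) : a * v + s - (t + b * v) = (a - b) * v + (s - t) by ring.
exact: E.
Qed.

Let circulation_transport i j h y : h != 0 ->
  \sum_(k < n) w k y * circulation (dV k) i j h y =
  - (c * circulation V i j h y) -
  \sum_(k < n) circulation (fun l x => (w k x - w k y) * A k l x) i j h y.
Proof.
move=> h0; have [Q QP] := gradQ.
have cwA k l : continuous (fun x => w k x * A k l x) by exact: continuous_mul.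
have cQ l : continuous (fun x => c * V l x + \sum_(k < n) w k x * A k l x).
  apply: continuous_add; last exact: continuous_sumr.
  by apply: continuous_mul => //; exact: cst_continuous.
have := circulation_gradient i j y h0 cQ QP.
rewrite circulationD; last 2 first.
- by move=> l; apply: continuous_mul => //; exact: cst_continuous.
- by move=> l; exact: continuous_sumr.
rewrite circulationZ// circulation_sum// => E.
have dVA k : circulation (dV k) i j h y = circulation (A k) i j h y.
  rewrite (_ : dV k = fun l x => A k l x + dV l k x); last first.
    by apply/funext => l; apply/funext => x; rewrite /A subrK.
  rewrite circulationD// (circulation_gradient _ _ _ h0 _ (fun l x => VdV l k x))//.
  by rewrite addr0.
have wA k : circulation (fun l x => (w k x - w k y) * A k l x) i j h y =
    circulation (fun l x => w k x * A k l x) i j h y - w k y * circulation (A k) i j h y.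
  have fE : (fun l x => (w k x - w k y) * A k l x) =
      (fun l x => w k x * A k l x + - w k y * A k l x).
    apply/funext => l; apply/funext => x.
    by move: (w k x) (w k y) (A k l x) => p q r; rewrite mulrBl mulNr.
  rewrite fE circulationD//; last first.
    by move=> l; apply: continuous_mul => //; exact: cst_continuous.
  by rewrite circulationZ// mulNr.
under eq_bigr do rewrite dVA.
under [X in _ = _ - X]eq_bigr do rewrite wA.
rewrite sumrB; move: E; set s := \sum_(_ < n) _; set t := \sum_(_ < n) _.
by move=> /eqP; rewrite addr_eq0 => /eqP ->; rewrite opprK opprB addrCA subrr addr0.
Qed.

Lemma steady_vorticity_eq0 i j x : dV i j x = dV j i x.
Proof.
pose W (x : rV) : rV := \row_k w k x.
(* Limit for small [h] of the last sum in [circulation_transport]: the curl at [y] of the forms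
   [(w k - w k y) A k], in which only the derivatives of [w k] remain. Thus [H] below is the formal
   value of [w.grad A]. *)
pose G (ij : 'I_n * 'I_n) (x : rV) : R := \sum_(k < n)
  (dw ij.1 k x * A k ij.2 x - dw ij.2 k x * A k ij.1 x).
pose H ij (x : rV) : R := - (c * A ij.1 ij.2 x) - G ij x.
(* [|c|] for the linear term, and the bound [L + |b|] on [dw] twice, for the two products in [G]. *)
pose K : R := `|c| + 2 * (L + `|b|).
have Lb0 : 0 <= L + `|b| by rewrite addr_ge0.
apply/eqP; rewrite -subr_eq0; apply/eqP.
apply: (@transport_liouville_family R n _ W (fun j => dw j j) (n%:R * b) (M + `|b|)
  (fun ij => A ij.1 ij.2) H (2 * L) K p1 _ _ _ _ _ _ _ _ _ _ _ _ p10 A_int (i, j) x).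
- by move=> k; under eq_fun do rewrite mxE; exact: cw.
- by move=> k y; under eq_fun do rewrite mxE; exact: wdw.
- by move=> k; exact: ucont_continuous.
- move=> y; rewrite /dw big_split/= divV add0r.
  by under eq_bigr do rewrite eqxx mulr1; rewrite sumr_const card_ord mulr_natl.
- by rewrite mulf_neq0// pnatr_eq0 -lt0n.
- move=> y; apply: ler_norm_coord => [|k]; first by rewrite mulr_ge0 ?addr_ge0.
  rewrite mxE /w (le_trans (ler_normD _ _))// normrM.
  have := ler_wpM2l (normr_ge0 b) (ler_coord_norm y k); have := VM k y.
  have := mulr_ge0 M0 (normr_ge0 y); have := normr_ge0 b; nra.
- by move=> ij; exact: cA.
- by rewrite mulr_ge0.
- by move=> ij y; exact: AL.
- by rewrite addr_ge0// mulr_ge0.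
- move=> [k l] y; rewrite /H /G /=; set S := \sum_(ij : 'I_n * 'I_n) _.
  have SA k' l' : `|A k' l' y| <= S.
    by rewrite /S (bigD1 (k', l'))//= lerDl sumr_ge0.
  have Sc l' : \sum_(k' < n) `|A k' l' y| <= S.
    rewrite /S -(pair_bigA _ (fun i j => `|A i j y|))/= ler_sum// => k' _.
    by rewrite (bigD1 l')//= lerDl sumr_ge0.
  rewrite (le_trans (ler_normB _ _))// /K [leRHS]mulrDl lerD//.
    by rewrite normrN normrM ler_wpM2l.
  rewrite (le_trans (ler_norm_sum _ _ _))//.
  apply: (@le_trans _ _ (\sum_(k' < n) ((L + `|b|) * `|A k' l y| + (L + `|b|) * `|A k' k y|))).
    apply: ler_sum => k' _; rewrite (le_trans (ler_normB _ _))// !normrM.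
    by rewrite lerD// ler_wpM2r.
  rewrite big_split/= -!mulr_sumr.
  by rewrite -mulrA mulr_natl mulr2n lerD// ler_wpM2l.
move=> e e0.
(* In units of [e1]: [2 |c|] for replacing the circulation of [V] by [A] in the linear term, [2 n]
   for the [n] circulations approximating [G], and 2 for the distance between the circulation of [V]
   and [A] itself. *)
pose D : R := 2 * (`|c| + n%:R) + 2.
have D0 : 0 < D by rewrite ltr_wpDl// mulr_ge0// addr_ge0.
pose e1 := e / D.
have e10 : 0 < e1 by rewrite divr_gt0.
have eE : e = e1 * D by rewrite /e1 divfK// gt_eqF.
(* Plain difference quotients of [V] are the case [g = 1] of [increment_mul_approx]. *)
have u1 : ucont (fun _ : rV => 1 : R).
  by move=> e' e'0; exists 1 => // y z _; rewrite subrr normr0 ltW.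
have [r1 r10 H1] : exists2 r : R, 0 < r & forall h, 0 < h < r ->
    forall l i j (s : R) y z, 0 <= s <= 1 -> z = s *: (h *: 'E_i) + y ->
    `|h^-1 * ((V l (h *: 'E_j + z) - V l y) * 1 - (V l z - V l y) * 1)
      - dV j l y * 1| <= e1.
  apply: fin_radius => l.
  apply: (@increment_mul_approx _ _ (V l) (fun=> 1) (dV ^~ l) L 1) => //.
  by move=> y; rewrite normr1.
have [r2 r20 H2] : exists2 r : R, 0 < r & forall h, 0 < h < r ->
    forall (kl : 'I_n * 'I_n) i j (s : R) y z, 0 <= s <= 1 -> z = s *: (h *: 'E_i) + y ->
    `|h^-1 * ((w kl.1 (h *: 'E_j + z) - w kl.1 y) * A kl.1 kl.2 (h *: 'E_j + z) -
      (w kl.1 z - w kl.1 y) * A kl.1 kl.2 z) - dw j kl.1 y * A kl.1 kl.2 y| <= e1.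
  apply: fin_radius => -[k l].
  apply: (@increment_mul_approx _ _ (w k) (A k l) (dw ^~ k) (L + `|b|) (2 * L)) => //.
pose h := Num.min r1 r2 / 2.
have r0 : 0 < Num.min r1 r2 by rewrite lt_min r10.
have h0 : 0 < h by rewrite divr_gt0.
have hr : h < Num.min r1 r2 by rewrite ltr_pdivrMr// ltr_pMr// ltr1n.
have hr1 : 0 < h < r1 by rewrite h0 (lt_le_trans hr)// ge_min lexx.
have hr2 : 0 < h < r2 by rewrite h0 (lt_le_trans hr)// ge_min lexx orbT.
exists (fun ij => circulation V ij.1 ij.2 h), (fun ij k => circulation (dV k) ij.1 ij.2 h).
have FA k l y : `|circulation V k l h y - A k l y| <= 2 * e1.
  apply: circulation_approx => // s s01 z zE.
    have := H1 h hr1 k k l s y z s01 zE; rewrite !mulr1.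
    by rewrite (_ : V k (h *: 'E_l + z) - V k y - (V k z - V k y) =
      V k (h *: 'E_l + z) - V k z)//; ring.
  have := H1 h hr1 l l k s y z s01 zE; rewrite !mulr1.
  by rewrite (_ : V l (h *: 'E_k + z) - V l y - (V l z - V l y) =
    V l (h *: 'E_k + z) - V l z)//; ring.
split.
- by move=> ij; apply: continuous_circulation.
- by move=> ij k; apply: continuous_circulation.
- by move=> ij k y; apply: is_derive_circulation.
move=> [k l] y /=; split.
  rewrite (le_trans (FA k l y))// eE mulrC ler_wpM2l ?(ltW e10)// /D lerDr.
  by rewrite mulr_ge0// addr_ge0.
under eq_bigr do rewrite mxE.
rewrite circulation_transport ?gt_eqF// /H /G /=.
set F := circulation V k l h y; set T := \sum_(_ < n) _; set T' := \sum_(_ < n) _.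
have E (p q s t : R) : - (c * p) - s - (- (c * q) - t) = - (c * (p - q)) - (s - t).
  by ring.
rewrite E.
have TT : `|T - T'| <= n%:R * (2 * e1).
  rewrite /T /T' -sumrB (le_trans (ler_norm_sum _ _ _))//.
  rewrite -[X in X%:R * _](card_ord n) -sum1_card natr_sum mulr_suml ler_sum// => m _.
  rewrite mul1r; apply: circulation_approx.
  - move=> l'; apply: continuous_mul => //.
    by apply: continuous_add => //; exact: cst_continuous.
  - by move=> s s01 z zE; exact: (H2 h hr2 (m, k) k l s y z s01 zE).
  - by move=> s s01 z zE; exact: (H2 h hr2 (m, l) l k s y z s01 zE).
rewrite (le_trans (ler_normB _ _))// normrN normrM.
have := ler_wpM2l (normr_ge0 c) (FA k l y).
rewrite -/F eE /D; nra.
Qed.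

End steady_vorticity.
(** * Fields without curl and divergence *)

Section maximum_principle.
Context {R : realType}.

(** If [c] were positive, [df], which vanishes at the maximum, would be positive just to the right
    of 0, and [f] would exceed [f 0] there. *)
Lemma second_derivative_max (f df : R -> R) (c : R) :
  (forall t, is_derive t (1 : R) f (df t)) -> is_derive (0 : R) (1 : R) df c ->
  (forall t, `|t| < 1 -> f t <= f 0) -> c <= 0.
Proof.
move=> fdf [dfD dfE] f0; rewrite leNgt; apply/negP => c0.
have cf : continuous f.
  move=> x; apply: differentiable_continuous; apply/derivable1_diffP.
  by have [] := fdf x.
have df0 : df 0 = 0.
  have H : is_derive (0 : R) (1 : R) f 0.
    apply: (@derive1_at_max R f (-1) 1 0).
    - lra.
    - by move=> t _; have [] := fdf t.
    - by rewrite in_itv/= ltrN10 ltr01.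
    - by move=> t; rewrite in_itv/= -ltr_norml; exact: f0.
  by have [_ <-] := fdf 0; have [_ ->] := H.
have cvc : h^-1 *: (df (h *: (1 : R) + 0) - df 0) @[h --> 0^'] --> c.
  by rewrite -dfE; exact: dfD.
have /nbhs_ballP[r /= r0 rP] : \forall h \near (0 : R)^',
    c / 2 < h^-1 *: (df (h *: (1 : R) + 0) - df 0).
  by apply: (cvgr_gt c) => //; rewrite ltr_pdivrMr// ltr_pMr// ltr1n.
pose t := Num.min (r / 2) (1 / 2).
have t0 : 0 < t by rewrite lt_min !divr_gt0.
have tr : t < r.
  by rewrite gt_min; apply/orP; left; rewrite ltr_pdivrMr// ltr_pMr// ltr1n.
have t1 : t < 1 by rewrite gt_min; apply/orP; right; lra.
have [|s] := @MVT R f df 0 t t0 (fun x _ => fdf x).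
  exact: continuous_subspaceT.
rewrite in_itv/= => /andP[s0 st] E.
have dfs : 0 < df s.
  have := rP s; rewrite /ball/= sub0r normrN gtr0_norm// => /(_ (lt_trans st tr)).
  rewrite gt_eqF// => /(_ isT); rewrite df0 subr0 addr0.
  rewrite (_ : s *: (1 : R) = s); last by rewrite /GRing.scale/= mulr1.
  rewrite (_ : s^-1 *: df s = s^-1 * df s)// => H.
  have : 0 < s^-1 * df s by rewrite (lt_trans _ H)// divr_gt0.
  by rewrite pmulr_rgt0// invr_gt0.
have := f0 t; rewrite gtr0_norm// => /(_ t1); rewrite -subr_le0 E subr0 leNgt.
by rewrite mulr_gt0.
Qed.

(** Adding [d |x|^2] to [u] makes the sum of the second derivatives equal to [2 d n > 0], which is
    impossible at an interior maximum. *)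
Lemma harmonic_vanishing_le0 n (u : 'rV[R]_n -> R) (g l : 'I_n -> 'rV[R]_n -> R) :
  (0 < n)%N -> continuous u -> vanishes_at_infinity u ->
  (forall k x, is_derive x (delta_mx 0 k) u (g k x)) ->
  (forall k x, is_derive x (delta_mx 0 k) (g k) (l k x)) ->
  (forall x, \sum_(k < n) l k x = 0) -> forall x, u x <= 0.
Proof.
move=> n0 cu vu ug gl l0 x0; rewrite leNgt; apply/negP => ux0.
have [M HM] := vu (u x0 / 2) (divr_gt0 ux0 (ltr0n _ 2)).
(* The ball of radius [r] contains [x0] and leaves room of size 1 around every point with
   [|x| <= M], so that a maximum located there is interior. *)
pose r := Num.max M `|x0| + 1.
have Mr : M + 1 <= r by rewrite lerD2r le_max lexx.
have x0r : `|x0| <= r by rewrite (@le_trans _ _ (Num.max M `|x0|)) ?lerDl// le_max lexx orbT.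
have r0 : 0 <= r by rewrite (le_trans _ x0r).
pose N : R := n%:R * r ^+ 2 + 1.
have N0 : 0 < N by rewrite ltr_wpDl// mulr_ge0// sqr_ge0.
(* On the ball the perturbation is at most [u x0 / 4]; where [u < u x0 / 2] the total stays below
   [u x0], which forces the maximum into [|x| <= M]. *)
pose d := u x0 / (4 * N).
have d0 : 0 < d by rewrite divr_gt0// mulr_gt0.
have sqr_le (x : 'rV[R]_n) : `|x| <= r -> sqnorm x <= N.
  move=> xr; rewrite /N (@le_trans _ _ (n%:R * r ^+ 2)) ?lerDl//.
  rewrite /sqnorm -[X in X%:R * _](card_ord n) -sum1_card natr_sum mulr_suml ler_sum// => i _.
  rewrite mul1r -[x 0 i ^+ 2]real_normK ?num_real// ler_pXn2r ?nnegrE//.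
  by rewrite (le_trans (ler_coord_norm _ _)).
pose psi x := u x + d * sqnorm x.
have cpsi : continuous psi.
  apply: continuous_add => //; apply: continuous_mul; first exact: cst_continuous.
  exact: continuous_sqnorm.
have cB : compact [set x : 'rV[R]_n | `|x| <= r] by exact: compact_norm_le.
have [||x1 /set_mem/= x1r x1P] := @EVT_max_rV R n psi _ _ cB.
- by exists x0.
- exact: continuous_subspaceT.
have psix0 : u x0 <= psi x1.
  apply: le_trans (x1P x0 (mem_set x0r)).
  by rewrite lerDl mulr_ge0 ?(ltW d0)// sumr_ge0// => i _; exact: sqr_ge0.
have x1M : `|x1| <= M.
  rewrite leNgt; apply/negP => /HM ux1.
  have : d * sqnorm x1 <= u x0 / 4.
    have -> : u x0 / 4 = d * N by rewrite /d; field; rewrite gt_eqF.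
    by rewrite ler_wpM2l ?(ltW d0)// sqr_le.
  have := ler_norm (u x1); rewrite /psi in psix0; lra.
have key k : l k x1 + 2 * d <= 0.
  pose e : 'rV[R]_n := delta_mx 0 k.
  apply: (@second_derivative_max (fun t : R => psi (t *: e + x1))
    (fun t : R => g k (t *: e + x1) + d * (2 * (t *: e + x1) 0 k))).
  - move=> t; apply: (@is_derive_on_line R n psi (fun x => g k x + d * (2 * x 0 k))) => x.
    have h := is_derive_mul (is_derive_cst d x e) (is_derive_sqnorm x k).
    by apply: is_derive_eq (is_deriveD (ug k x) h) _; rewrite mul0r add0r.
  - have h : is_derive x1 e (fun x => g k x + d * (2 * x 0 k)) (l k x1 + 2 * d).
      have h1 := is_derive_mul (is_derive_cst (2 : R) x1 e) (is_derive_coord x1 e k).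
      have h2 := is_derive_mul (is_derive_cst d x1 e) h1.
      apply: is_derive_eq (is_deriveD (gl k x1) h2) _.
      by rewrite !mul0r !add0r mxE !eqxx/= mulr1 mulrC.
    by move/is_derive_lineP : h; exact.
  - move=> t t1; rewrite scale0r add0r; apply/x1P/mem_set => /=.
    rewrite (le_trans (ler_normD _ _))// (le_trans _ Mr)// addrC lerD//.
    rewrite normrZ -[leRHS]mulr1 ler_pM ?(ltW t1)//; exact: norm_delta_row.
have : \sum_(k < n) (l k x1 + 2 * d) <= 0 by rewrite sumr_le0.
rewrite big_split/= l0 add0r sumr_const card_ord leNgt.
have d2 : 0 < 2 * d by rewrite mulr_gt0.
by rewrite mulrn_wgt0 ?n0.
Qed.

Lemma harmonic_vanishing_eq0 n (u : 'rV[R]_n -> R) (g l : 'I_n -> 'rV[R]_n -> R) :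
  (0 < n)%N -> continuous u -> vanishes_at_infinity u ->
  (forall k x, is_derive x (delta_mx 0 k) u (g k x)) ->
  (forall k x, is_derive x (delta_mx 0 k) (g k) (l k x)) ->
  (forall x, \sum_(k < n) l k x = 0) -> forall x, u x = 0.
Proof.
move=> n0 cu vu ug gl l0 x; apply/eqP; rewrite eq_le.
rewrite (harmonic_vanishing_le0 n0 cu vu ug gl l0)/= -oppr_le0.
apply: (@harmonic_vanishing_le0 n (fun x => - u x) (fun k x => - g k x)
  (fun k x => - l k x)) => //.
- exact: continuous_opp.
- by move=> e e0; have [M HM] := vu e e0; exists M => y /HM; rewrite normrN.
- by move=> y; rewrite sumrN l0 oppr0.
Qed.

(* The increment u(x) = int_0^1 V(x + s v) . v ds of a potential of V has
   gradient V(x + v) - V(x), so it is a C^2 harmonic function vanishing at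
   infinity although V is only C^1. *)
Lemma curl_div_free_eq0 n (V : 'I_n -> 'rV[R]_n -> R)
    (dV : 'I_n -> 'I_n -> 'rV[R]_n -> R) :
  (0 < n)%N ->
  (forall v i x, is_derive x v (V i) (\sum_(j < n) v 0 j * dV j i x)) ->
  (forall i, ucont (V i)) -> (forall i, vanishes_at_infinity (V i)) ->
  (forall j i, ucont (dV j i)) ->
  (forall x, \sum_(j < n) dV j j x = 0) ->
  (forall j i x, dV j i x = dV i j x) -> forall i x, V i x = 0.
Proof.
move=> n0 VdV uV vV udV divV curlV.
have cV i : continuous (V i) by exact: ucont_continuous.
have cdV j i : continuous (dV j i) by exact: ucont_continuous.
have VdVe j i x : is_derive x (delta_mx 0 j) (V i) (dV j i x).
  apply: is_derive_eq (VdV (delta_mx 0 j) i x) _.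
  rewrite (bigD1 j)//= mxE !eqxx mul1r big1 ?addr0// => k kj.
  by rewrite mxE (negbTE kj) andbF mul0r.
have shift k (v x : 'rV[R]_n) : V k (v + x) = V k x.
  pose u (x : 'rV[R]_n) := \sum_(i < n) v 0 i * segment_mean (V i) v x.
  have useg j y : is_derive y (delta_mx 0 j) u (V j (v + y) - V j y).
    (* Symmetry of [dV] turns [sum_i v_i d_j V_i] into the derivative of [V j] along [v], whose mean
       over the segment is the increment. *)
    have <- : \sum_(i < n) v 0 i * segment_mean (dV j i) v y = V j (v + y) - V j y.
      rewrite -(segment_mean_derive _ (VdV v j)); last first.
        by apply: continuous_sumr => i; apply: continuous_mul => //; exact: cst_continuous.
      rewrite segment_mean_sum; last first.
        by move=> i; apply: continuous_mul => //; exact: cst_continuous.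
      apply: eq_bigr => i _; rewrite segment_meanZ//; congr (_ * segment_mean _ _ _).
      by apply/funext => z; exact: curlV.
    apply: is_derive_bigsum => i.
    have h := is_derive_segment_mean v (cV i) (VdVe j i) (udV j i) y.
    by have := is_derive_mul (is_derive_cst (v 0 i) y (delta_mx 0 j)) h; rewrite mul0r add0r.
  have cu : continuous u.
    apply: continuous_sumr => i; apply: continuous_mul; first exact: cst_continuous.
    by apply: ucont_continuous; exact: ucont_segment_mean.
  have vu : vanishes_at_infinity u.
    move=> e e0; pose D := n%:R * `|v| + 1.
    have D0 : 0 < D by rewrite ltr_wpDl// mulr_ge0.
    have /choice[M HM] : forall i, exists M : R, forall x, M < `|x| -> `|V i x| < e / D.
      by move=> i; apply: vV; rewrite divr_gt0.
    exists (\big[Num.max/0]_i M i + `|v|) => y yM.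
    have seg i : `|segment_mean (V i) v y| <= e / D.
      rewrite -[X in `|X|]subr0; apply: mean_dist_le => [|s /andP[s0 s1]].
        exact: continuous_on_line.
      rewrite subr0 ltW//; apply: HM.
      have Mi : M i <= \big[Num.max/0]_i M i by exact: le_bigmax.
      have : `|s *: v| <= `|v| by rewrite normrZ ger0_norm// ler_piMl.
      have := ler_normB (s *: v + y) (s *: v); rewrite addrAC subrr add0r.
      by move=> h1 h2; lra.
    rewrite (le_lt_trans (ler_norm_sum _ _ _))//.
    apply: (@le_lt_trans _ _ (n%:R * (`|v| * (e / D)))).
      rewrite -[X in X%:R * _](card_ord n) -sum1_card natr_sum mulr_suml ler_sum// => i _.
      by rewrite mul1r normrM ler_pM// ler_coord_norm.
    rewrite mulrA mulrCA -[ltRHS]mulr1 ltr_pM2l// ltr_pdivrMr// mul1r /D.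
    by rewrite ltrDl.
  have u0 : forall y, u y = 0.
    apply: (@harmonic_vanishing_eq0 n u (fun j y => V j (v + y) - V j y)
      (fun j y => dV j j (v + y) - dV j j y)) => //.
    - move=> j y.
      have h : is_derive y (delta_mx 0 j) (fun y => V j (v + y)) (dV j j (v + y)).
        apply/is_derive_lineP; have /is_derive_lineP := VdVe j j (v + y).
        by under [X in is_derive _ _ X]eq_fun do rewrite addrCA.
      exact: (is_deriveB h (VdVe j j y)).
    - by move=> y; rewrite sumrB !divV subrr.
  (* [u] is identically zero, so its partial derivative in direction [k], which is the increment of
     [V k], is zero too. *)
  apply/eqP; rewrite -subr_eq0; apply/eqP.
  have [_ <-] := useg k x; have -> : u = cst 0 by apply/funext => y; exact: u0.
  by rewrite derive_cst.
move=> i x; apply/eqP; rewrite -normr_le0; apply/ler_addgt0Pr => e e0.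
have [M HM] := vV i e e0; rewrite add0r ltW//.
(* [V i] is invariant under every translation; this one carries [x] beyond the radius [M], where
   [|V i| < e]. *)
pose v : 'rV[R]_n := const_mx (`|M| + 1 + `|x|).
rewrite -(shift i v x); apply: HM.
have i0 : 'I_n := Ordinal n0.
have vn : `|M| + 1 + `|x| <= `|v|.
  have := ler_coord_norm v i0; rewrite mxE ger0_norm ?addr_ge0//.
have := ler_normB (v + x) x; rewrite addrK; have := ler_norm M; lra.
Qed.

End maximum_principle.
(** * The profile equations *)

Section self_similar_profile.
Context {R : realType}.

Lemma is_derive_rowP (E : normedModType R) n (f : E -> 'rV[R]_n) (x v : E) (d : 'rV[R]_n) :
  (forall i, is_derive x v (fun y => f y 0 i) (d 0 i)) -> is_derive x v f d.
Proof.
move=> fd.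
have fD : derivable f x v.
  by apply/derivable_mxP => i j; rewrite (ord1 i); have [] := fd j.
apply: DeriveDef => //; apply/rowP => i.
by rewrite derive_mx// mxE; have [_ ->] := fd i.
Qed.

Lemma is_derive_differentiable n (f : 'rV[R]_n -> R) x v : differentiable f x ->
  is_derive x v f (\sum_(j < n) v 0 j * partial j f x).
Proof.
move=> fx; apply: DeriveDef; first exact: diff_derivable.
rewrite deriveE// {1}(row_sum_delta v) linear_sum; apply: eq_bigr => j _.
by rewrite linearZ/= /partial deriveE.
Qed.

Lemma is_derive_differentiable_partial n (f : 'rV[R]_n -> R) x j : differentiable f x ->
  is_derive x (delta_mx 0 j) f (partial j f x).
Proof. by move=> fx; apply: DeriveDef => //; exact: diff_derivable. Qed.

Lemma is_derive_rescale n (f : 'rV[R]_n -> R) (c : R) x v d :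
  is_derive (c *: x) v f d -> is_derive x v (fun y => f (c *: y)) (c * d).
Proof.
move=> /(is_deriveZ_dir c)/is_derive_lineP h; apply/is_derive_lineP.
by under [X in is_derive _ _ X]eq_fun do rewrite scalerDr scalerA mulrC -scalerA.
Qed.

Section C1_0_components.
Variables (n : nat) (W : 'rV[R]_n -> 'rV[R]_n).
Hypothesis C1W : C1_0 W.

Lemma C1_0_differentiable i x : differentiable (fun y => W y 0 i) x.
Proof.
have [/(_ x I)[dW _] _ _] := C1W.
apply: (@differentiable_comp _ _ _ _ W (fun y : 'rV[R]_n => y 0 i)) => //.
exact: differentiable_coord.
Qed.

Lemma C1_0_partialE i j x : partial j (fun y => W y 0 i) x = ('D_(delta_mx 0 j) W x) 0 i.
Proof.
have [/(_ x I)[dW _] _ _] := C1W.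
by rewrite derive_mx ?mxE//; exact: diff_derivable.
Qed.

Lemma C1_0_continuous i : continuous (fun y => W y 0 i).
Proof. by move=> x; apply: differentiable_continuous; exact: C1_0_differentiable. Qed.

Lemma C1_0_vanishing i : vanishes_at_infinity (fun y => W y 0 i).
Proof.
have [_ vW _] := C1W => e e0; have [M HM] := vW e e0.
by exists M => x /HM; apply: le_lt_trans; exact: ler_coord_norm.
Qed.

Lemma C1_0_ucont i : ucont (fun y => W y 0 i).
Proof. by apply: vanishing_ucont; [exact: C1_0_continuous|exact: C1_0_vanishing]. Qed.

Lemma C1_0_partial_continuous i j : continuous (partial j (fun y => W y 0 i)).
Proof.
have [C1 _ _] := C1W.
rewrite (_ : partial _ _ = (fun x => ('D_(delta_mx 0 j) W x) 0 i)); last first.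
  by apply/funext => x; exact: C1_0_partialE.
move=> x; apply: (@continuous_comp _ _ _ ('D_(delta_mx 0 j) W) (fun y : 'rV[R]_n => y 0 i)).
  by have [_] := C1 x I; exact.
exact: continuous_coord.
Qed.

Lemma C1_0_partial_vanishing i j : vanishes_at_infinity (partial j (fun y => W y 0 i)).
Proof.
have [_ _ vW] := C1W => e e0; have [M HM] := vW (delta_mx 0 j) e e0.
exists M => x /HM; apply: le_lt_trans; rewrite C1_0_partialE; exact: ler_coord_norm.
Qed.

Lemma C1_0_partial_ucont i j : ucont (partial j (fun y => W y 0 i)).
Proof.
by apply: vanishing_ucont; [exact: C1_0_partial_continuous|exact: C1_0_partial_vanishing].
Qed.

Lemma C1_0_bounded : exists2 K : R, 0 <= K &
  (forall i x, `|W x 0 i| <= K) /\ forall i j x, `|partial j (fun y => W y 0 i) x| <= K.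
Proof.
have [K1 HK1] : exists K, forall i x, `|W x 0 i| <= K.
  have /choice[K HK] : forall i, exists K : R, forall x, `|W x 0 i| <= K.
    move=> i; have [K _ HK] : exists2 K : R, 0 <= K & forall x, `|W x 0 i| <= K.
      by apply: vanishing_bounded; [exact: C1_0_continuous|exact: C1_0_vanishing].
    by exists K.
  by exists (\big[Num.max/0]_i K i) => i x; rewrite (le_trans (HK i x))// le_bigmax.
have [K2 HK2] : exists K, forall i j x, `|partial j (fun y => W y 0 i) x| <= K.
  have /choice[K HK] : forall ij : 'I_n * 'I_n, exists K : R,
      forall x, `|partial ij.2 (fun y => W y 0 ij.1) x| <= K.
    move=> [i j].
    have [K _ HK] : exists2 K : R, 0 <= K &
        forall x, `|partial j (fun y => W y 0 i) x| <= K.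
      apply: vanishing_bounded; first exact: C1_0_partial_continuous.
      exact: C1_0_partial_vanishing.
    by exists K.
  exists (\big[Num.max/0]_ij K ij) => i j x.
  by rewrite (le_trans (HK (i, j) x))// le_bigmax.
exists (Num.max 0 (Num.max K1 K2)); first by rewrite le_max lexx.
split=> [i x|i j x]; rewrite !le_max ?HK1 ?HK2 ?orbT//.
Qed.

End C1_0_components.

Section rescaling.
Variables (n : nat) (T alpha : R).
Hypothesis T0 : 0 < T.
Hypothesis alphaN1 : alpha <> -1.
Let b : R := (alpha + 1)^-1.
(** At half the life span the remaining time [T - tau] is again [tau], which simplifies every power;
    the profile equations can be read off at any single time. *)
Let tau : R := T / 2.
Let sigma : R := (tau `^ (alpha / (alpha + 1)))^-1.
Let rho : R := (tau `^ (1 / (alpha + 1)))^-1.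

Let a10 : alpha + 1 != 0. Proof. by rewrite addr_eq0; apply/eqP. Qed.
Let tau0 : 0 < tau. Proof. by rewrite divr_gt0. Qed.
Let TtauE : T - tau = tau. Proof. by rewrite /tau; field. Qed.
Let tauT : 0 < tau < T.
Proof. by rewrite tau0/= /tau ltr_pdivrMr// ltr_pMr// ltr1n. Qed.

Lemma time_scale_gt0 : 0 < sigma. Proof. by rewrite invr_gt0 powR_gt0. Qed.
Lemma space_scale_gt0 : 0 < rho. Proof. by rewrite invr_gt0 powR_gt0. Qed.

(** The two exponents add up to 1. This is the scaling of the equations: it gives the advection
    terms the same factor [sigma / tau] as the time derivative. *)
Let sigma_rho : sigma * rho = tau^-1.
Proof.
rewrite /sigma /rho -invfM -powRD; last by rewrite (gt_eqF tau0) implybT.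
by rewrite -mulrDl divff// powRr1// ltW.
Qed.

Let is_derive_powR_inv (c : R) :
  is_derive tau (1 : R) (fun t : R => ((T - t) `^ c)^-1) (c * (tau `^ c)^-1 / tau).
Proof.
under eq_fun do rewrite -powRN.
have h1 : is_derive tau (1 : R) (fun t : R => T - t) (-1).
  apply: is_derive_eq (is_deriveB (is_derive_cst T tau (1 : R)) (is_derive_id tau (1 : R))) _.
  by rewrite sub0r.
have Tt : 0 < T - tau by rewrite TtauE.
have := @is_derive1_comp R (@powR R ^~ (- c)) (fun t : R => T - t) tau _ _
  (is_derive1_powR (- c) Tt) h1.
rewrite TtauE mulrN1 mulNr opprK powRB; last by rewrite (gt_eqF tau0) implybT.
by rewrite powRr1 ?(ltW tau0)// -powRN mulrA.
Qed.

Section profile.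
Variables (u : 'rV[R]_n -> R -> 'rV[R]_n) (U : 'rV[R]_n -> 'rV[R]_n).
Hypothesis ssU : self_similar T alpha u U.
Hypothesis C1U : C1_0 U.

Let dU (j i : 'I_n) := partial j (fun y => U y 0 i).

Lemma self_similar_tau x : u x tau = sigma *: U (rho *: x).
Proof. by rewrite ssU// TtauE. Qed.

Lemma self_similar_derive1 x i : derive1 (u x) tau 0 i =
  sigma / tau * (alpha * b * U (rho *: x) 0 i +
    b * \sum_(j < n) (rho *: x) 0 j * dU j i (rho *: x)).
Proof.
pose s (t : R) := ((T - t) `^ (alpha / (alpha + 1)))^-1.
pose r (t : R) := ((T - t) `^ (1 / (alpha + 1)))^-1.
pose f (t : R) : 'rV[R]_n := s t *: U (r t *: x).
(* The ansatz holds for [0 < t < T] only, so [u x] is replaced by the formula near [tau] before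
   differentiating. *)
have uf : \forall t \near tau, u x t = f t.
  near=> t; rewrite ssU//; apply/andP; split; near: t.
    by apply: lt_nbhsr; case/andP: tauT.
  by apply: lt_nbhsl; case/andP: tauT.
have df : is_derive tau (1 : R) f (\row_i (alpha * b * sigma / tau * U (rho *: x) 0 i +
    sigma * (\sum_(j < n) x 0 j * dU j i (rho *: x) * (b * rho / tau)))).
  apply: is_derive_rowP => k; rewrite mxE.
  rewrite (_ : (fun y => f y 0 k) = (fun t => s t * U (r t *: x) 0 k)); last first.
    by apply/funext => t; rewrite mxE.
  have hs : is_derive tau (1 : R) s (alpha * b * sigma / tau).
    by have := is_derive_powR_inv (alpha / (alpha + 1)); rewrite /s /sigma /b.
  have hr : is_derive tau (1 : R) r (b * rho / tau).
    by have := is_derive_powR_inv (1 / (alpha + 1)); rewrite /r /rho /b div1r.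
  have hG (t : R) : is_derive t (1 : R) (fun t : R => U (t *: x) 0 k)
      (\sum_(j < n) x 0 j * dU j k (t *: x)).
    have := @is_derive_on_line R n (fun y => U y 0 k)
      (fun y => \sum_(j < n) x 0 j * dU j k y) x 0 t
      (fun y => is_derive_differentiable x (C1_0_differentiable C1U k y)).
    by rewrite addr0; under [X in is_derive _ _ X]eq_fun do rewrite addr0.
  have rt : r tau = rho by rewrite /r TtauE.
  apply: is_derive_eq (is_derive_mul hs (is_derive1_comp (hG (r tau)) hr)) _.
  by rewrite /= rt /s TtauE -/sigma mulr_suml.
rewrite derive1E (near_eq_derive _ uf); have [_ ->] := df.
rewrite mxE !mulr_sumr mulrDr.
congr (_ + _); first by ring.
rewrite mulr_sumr; apply: eq_bigr => j _; rewrite mxE; ring.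
Unshelve. all: by end_near. Qed.

Let is_derive_space x i j : is_derive x (delta_mx 0 j) (fun y => u y tau 0 i)
  (tau^-1 * dU j i (rho *: x)).
Proof.
rewrite (_ : (fun y => u y tau 0 i) = (fun y => sigma * U (rho *: y) 0 i)); last first.
  by apply/funext => y; rewrite self_similar_tau mxE.
have h1 : is_derive x (delta_mx 0 j) (fun y => U (rho *: y) 0 i) (rho * dU j i (rho *: x)).
  apply: (@is_derive_rescale n (fun y => U y 0 i)).
  exact: is_derive_differentiable_partial (C1_0_differentiable C1U i (rho *: x)).
have := is_derive_mul (is_derive_cst sigma x (delta_mx 0 j : 'rV[R]_n)) h1.
by rewrite mul0r add0r mulrA sigma_rho.
Qed.

Lemma self_similar_partial x j :
  partial j (u^~ tau) x = tau^-1 *: \row_i dU j i (rho *: x).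
Proof.
have [//] : is_derive x (delta_mx 0 j) (u^~ tau) (tau^-1 *: \row_i dU j i (rho *: x)).
by apply: is_derive_rowP => i; rewrite !mxE; exact: is_derive_space.
Qed.

Lemma self_similar_divergence x :
  divergence (u^~ tau) x = tau^-1 * \sum_(j < n) dU j j (rho *: x).
Proof.
rewrite mulr_sumr; apply: eq_bigr => j _.
by have [_] := is_derive_space x j j.
Qed.

End profile.

Lemma self_similar_advection (u w : 'rV[R]_n -> R -> 'rV[R]_n)
    (U W : 'rV[R]_n -> 'rV[R]_n) x i :
  self_similar T alpha u U -> self_similar T alpha w W -> C1_0 W ->
  advection (u^~ tau) (w^~ tau) x 0 i =
  sigma / tau * \sum_(j < n) U (rho *: x) 0 j * partial j (fun y => W y 0 i) (rho *: x).
Proof.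
move=> ssU ssW C1W; rewrite /advection summxE mulr_sumr; apply: eq_bigr => j _.
rewrite (self_similar_partial ssW C1W) (self_similar_tau ssU) !mxE; ring.
Qed.

Section profile_equations.
Variables (v0 h0 : 'rV[R]_n -> 'rV[R]_n) (v h : 'rV[R]_n -> R -> 'rV[R]_n).
Variables (V B : 'rV[R]_n -> 'rV[R]_n).
Hypothesis sol : classical_MHD_solution T v0 h0 v h.
Hypotheses (ssV : self_similar T alpha v V) (ssB : self_similar T alpha h B).
Hypotheses (C1V : C1_0 V) (C1B : C1_0 B).

Let d (U : 'rV[R]_n -> 'rV[R]_n) (j i : 'I_n) := partial j (fun y => U y 0 i).

(** The equations are evaluated at [rho^-1 y], so that the argument [y] of the profiles runs through
    all of R^n. *)
Let rhoV y : rho *: (rho^-1 *: y) = y :> 'rV[R]_n.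
Proof. by rewrite scalerA divff ?scale1r// gt_eqF// space_scale_gt0. Qed.

Let st0 : 0 < sigma / tau. Proof. by rewrite divr_gt0// time_scale_gt0. Qed.

Lemma profile_divergence y : \sum_(j < n) d V j j y = 0.
Proof.
have [_ _ _ _ [p Hp]] := sol; have [_ /(_ (rho^-1 *: y))[_ _ + _]] := Hp tau tauT.
rewrite (self_similar_divergence ssV C1V) rhoV => /eqP.
by rewrite mulf_eq0 invr_eq0 (gt_eqF tau0) => /eqP.
Qed.

Lemma profile_induction i y :
  alpha * b * B y 0 i + \sum_(j < n) (V y 0 j + b * y 0 j) * d B j i y =
  \sum_(j < n) B y 0 j * d V j i y.
Proof.
have [_ _ _ _ [p Hp]] := sol; have [_ /(_ (rho^-1 *: y))[_ + _ _]] := Hp tau tauT.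
move=> /rowP/(_ i); rewrite mxE (self_similar_derive1 ssB C1B).
rewrite (self_similar_advection _ _ ssV ssB C1B) (self_similar_advection _ _ ssB ssV C1V).
rewrite rhoV -mulrDr => /(mulfI (lt0r_neq0 st0)) <-.
rewrite mulr_sumr -addrA -big_split/=; congr (_ + _); apply: eq_bigr => j _.
by rewrite mulrDl addrC mulrA.
Qed.

Lemma profile_momentum : (forall x, B x = 0) ->
  exists (P : 'rV[R]_n -> R) (dP : 'I_n -> 'rV[R]_n -> R),
    (forall i y, is_derive y (delta_mx 0 i) P (dP i y)) /\
    forall i y, alpha * b * V y 0 i + \sum_(j < n) (V y 0 j + b * y 0 j) * d V j i y =
      - dP i y.
Proof.
move=> B0; have [_ _ _ _ [p Hp]] := sol; have [C1p mhd] := Hp tau tauT.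
(* The factor [rho] offsets the inner derivative of [rho^-1 y], and [tau / sigma] removes the common
   factor of the other terms. *)
exists (fun y => tau / sigma * rho * p (rho^-1 *: y) tau),
  (fun i y => tau / sigma * partial i (p^~ tau) (rho^-1 *: y)).
have sr0 : sigma != 0 by rewrite gt_eqF// time_scale_gt0.
have rr0 : rho != 0 by rewrite gt_eqF// space_scale_gt0.
have tt0 : tau != 0 by rewrite gt_eqF.
split=> i y.
  have [dp _] := C1p (rho^-1 *: y) I.
  have h1 := is_derive_rescale (is_derive_differentiable_partial i dp).
  have h2 := is_derive_cst (tau / sigma * rho) y (delta_mx 0 i : 'rV[R]_n).
  apply: is_derive_eq (is_derive_mul h2 h1) _.
  by rewrite mul0r add0r mulrA /cst mulfK.
have [+ _ _ _] := mhd (rho^-1 *: y).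
move=> /rowP/(_ i); rewrite mxE (self_similar_derive1 ssV C1V).
rewrite (self_similar_advection _ _ ssV ssV C1V) [in RHS]mxE.
rewrite (self_similar_advection _ _ ssB ssB C1B) rhoV -mulrDr.
rewrite [X in sigma / tau * X + _]big1 ?mulr0 ?add0r; last first.
  by move=> j _; rewrite B0 mxE mul0r.
rewrite !mxE (_ : (fun y => p y tau + 2^-1 * enorm (h y tau) ^+ 2) = p^~ tau); last first.
  apply/funext => z; rewrite (self_similar_tau ssB) B0 scaler0.
  by rewrite /enorm big1 ?sqrtr0 ?expr0n/= ?mulr0 ?addr0// => k _; rewrite mxE expr0n.
move=> E; rewrite -mulrN -E mulrA (_ : tau / sigma * (sigma / tau) = 1); last first.
  by field; rewrite tt0.
rewrite mul1r mulr_sumr -addrA -big_split/=; congr (_ + _); apply: eq_bigr => j _.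
by rewrite mulrDl addrC mulrA.
Qed.

End profile_equations.

End rescaling.

End self_similar_profile.

(** * Vanishing of the magnetic and velocity profiles *)

Section rigidity.
Context {R : realType} {n : nat}.
Variables (T alpha : R) (v0 b0 : 'rV[R]_n -> 'rV[R]_n) (v b : 'rV[R]_n -> R -> 'rV[R]_n).
Variables (V B : 'rV[R]_n -> 'rV[R]_n) (p1 : R).
Hypotheses (n0 : (0 < n)%N) (T0 : 0 < T) (alphaN1 : alpha <> -1) (p10 : 0 < p1).
Hypothesis sol : classical_MHD_solution T v0 b0 v b.
Hypotheses (ssV : self_similar T alpha v V) (ssB : self_similar T alpha b B).
Hypotheses (C1V : C1_0 V) (C1B : C1_0 B).

Let beta : R := (alpha + 1)^-1.
Let d (U : 'rV[R]_n -> 'rV[R]_n) (j i : 'I_n) := partial j (fun y => U y 0 i).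

Let beta0 : beta != 0.
Proof. by rewrite invr_eq0 addr_eq0; apply/eqP. Qed.

(** The induction equation is linear in [B], with coefficients controlled by [MV + |alpha beta|].
    Since [B] is C^1, it serves as its own approximant. *)
Lemma magnetic_profile_eq0 :
  (forall p, 0 < p < p1 ->
    (\int[lebesgue_tuple n]_t
      ((\sum_i B (row_of_tuple t) 0 i ^+ 2) `^ p)%:E < +oo)%E) ->
  forall x, B x = 0.
Proof.
move=> B_int x; apply/rowP => i; rewrite mxE.
have [MV MV0 [VM dVM]] := C1_0_bounded C1V.
have [MB MB0 [BM dBM]] := C1_0_bounded C1B.
pose H (i : 'I_n) y := \sum_(j < n) B y 0 j * d V j i y - alpha * beta * B y 0 i.
have VdV j k y := is_derive_differentiable_partial j (C1_0_differentiable C1V k y).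
have BdB j k y := is_derive_differentiable_partial j (C1_0_differentiable C1B k y).
pose w (y : 'rV[R]_n) : 'rV[R]_n := \row_k (V y 0 k + beta * y 0 k).
apply: (@transport_liouville_family R n _ w (fun j y => d V j j y + beta) (n%:R * beta)
  (MV + `|beta|) (fun i y => B y 0 i) H MB (MV + `|alpha * beta|) p1
  _ _ _ _ _ _ _ _ _ _ _ _ p10 B_int i x) => {x i}.
- move=> k; under eq_fun do rewrite mxE.
  apply: continuous_add; first exact: C1_0_continuous.
  by apply: continuous_mul; [exact: cst_continuous|exact: continuous_coord].
- move=> k y; under eq_fun do rewrite mxE.
  have h := is_derive_mul (is_derive_cst beta y (delta_mx 0 k : 'rV[R]_n))
    (is_derive_coord y (delta_mx 0 k) k).
  apply: is_derive_eq (is_deriveD (VdV k k y) h) _.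
  by rewrite mul0r add0r mxE !eqxx mulr1.
- move=> k; apply: continuous_add; last exact: cst_continuous.
  exact: C1_0_partial_continuous.
- move=> y; rewrite big_split/= (profile_divergence T0 alphaN1 sol ssV C1V) add0r.
  by rewrite sumr_const card_ord mulr_natl.
- by rewrite mulf_neq0// pnatr_eq0 -lt0n.
- move=> y; apply: ler_norm_coord => [|k]; first by rewrite mulr_ge0 ?addr_ge0.
  rewrite mxE (le_trans (ler_normD _ _))// normrM.
  have := ler_wpM2l (normr_ge0 beta) (ler_coord_norm y k); have := VM k y.
  have := mulr_ge0 MV0 (normr_ge0 y); have := normr_ge0 beta; nra.
- by move=> k; exact: C1_0_continuous.
- by [].
- by move=> k y; exact: BM.
- by rewrite addr_ge0.
- move=> k y; rewrite /H (le_trans (ler_normB _ _))// [leRHS]mulrDl lerD//.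
    rewrite (le_trans (ler_norm_sum _ _ _))// mulr_sumr ler_sum// => j _.
    by rewrite normrM mulrC ler_wpM2r// dVM.
  by rewrite normrM ler_wpM2l// (bigD1 k)//= lerDl sumr_ge0.
- move=> e e0; exists (fun i y => B y 0 i), (fun i j y => d B j i y); split.
  + by move=> k; exact: C1_0_continuous.
  + by move=> k j; exact: C1_0_partial_continuous.
  + by move=> k j y; exact: BdB.
  + move=> k y; rewrite subrr normr0 ltW//; split => //.
    under eq_bigr do rewrite mxE.
    have := profile_induction T0 alphaN1 sol ssV ssB C1V C1B k y.
    rewrite /H => <-; rewrite [X in _ - X]addrAC subrr add0r.
    by rewrite subrr normr0 ltW.
Qed.

Lemma velocity_profile_eq0 :
  (forall p, 0 < p < p1 ->
    (\int[lebesgue_tuple n]_t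
      ((\sum_(ij : 'I_n * 'I_n) (d V ij.1 ij.2 (row_of_tuple t) -
         d V ij.2 ij.1 (row_of_tuple t)) ^+ 2) `^ p)%:E < +oo)%E) ->
  (forall x, B x = 0) -> forall x, V x = 0.
Proof.
move=> A_int B0.
have [MV MV0 [VM dVM]] := C1_0_bounded C1V.
have VdV j k y := is_derive_differentiable_partial j (C1_0_differentiable C1V k y).
have [P [dP [PdP eqV]]] := profile_momentum T0 alphaN1 sol ssV ssB C1V C1B B0.
have divV := profile_divergence T0 alphaN1 sol ssV C1V.
have curlV := @steady_vorticity_eq0 R n (fun i y => V y 0 i) (d V) P dP (alpha * beta) beta
  MV MV p1 VdV (C1_0_ucont C1V) VM MV0 (fun j i => C1_0_partial_ucont C1V i j) MV0
  (fun j i => dVM i j) divV beta0 n0 PdP eqV p10 A_int.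
move=> x; apply/rowP => i; rewrite mxE.
apply: (@curl_div_free_eq0 R n (fun i y => V y 0 i) (d V)) => //.
- by move=> w k y; exact: is_derive_differentiable (C1_0_differentiable C1V k y).
- exact: C1_0_ucont.
- exact: C1_0_vanishing.
- by move=> j k; exact: C1_0_partial_ucont.
Qed.

End rigidity.

(** * From Lebesgue classes to the integrals of the Liouville principle *)

Section Lebesgue_classes.
Context {R : realType} {n : nat}.

(** [s] is a multiple of a squared norm, so its [p]-th power is a multiple of the [2 p]-th power of
    the norm; [c] absorbs the factor between [|A|^2] and [|curl V|^2]. *)
Lemma Lebesgue_class_sqr k (f : 'rV[R]_n -> 'rV[R]_k) (c p : R) (s : 'rV[R]_n -> R) :
  0 <= c -> (forall x, s x = c * \sum_(i < k) f x 0 i ^+ 2) ->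
  Lebesgue_class (2 * p) f ->
  (\int[lebesgue_tuple n]_t (s (row_of_tuple t) `^ p)%:E < +oo)%E.
Proof.
move=> c0 sE [mf If].
have fE x : s x `^ p = c `^ p * enorm (f x) `^ (2 * p).
  have S0 : 0 <= \sum_(i < k) f x 0 i ^+ 2 by apply: sumr_ge0 => i _; exact: sqr_ge0.
  rewrite sE powRM// /enorm -powR12_sqrt// -powRrM mulrA mulVf ?mul1r//.
have mg : measurable_fun [set: n.-tuple R]
    (fun t => (enorm (f (row_of_tuple t)) `^ (2 * p))%:E).
  apply/measurable_EFinP; apply: (measurableT_comp (measurable_powR _)).
  rewrite (_ : (fun _ => _) =
      fun t => (\sum_(i < k) f (row_of_tuple t) 0 i ^+ 2) `^ 2^-1); last first.
    by apply/funext => t; rewrite powR12_sqrt// sumr_ge0// => i _; exact: sqr_ge0.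
  apply: (measurableT_comp (measurable_powR _)).
  by apply: measurable_sum => i; apply: measurable_funX; exact: mf.
under eq_integral do rewrite fE EFinM.
rewrite ge0_integralZl//; last 2 first.
- by move=> t _; rewrite lee_fin powR_ge0.
- by rewrite lee_fin powR_ge0.
by rewrite lte_mul_pinfty ?lee_fin ?powR_ge0.
Qed.

End Lebesgue_classes.

(** Each unordered pair of distinct indices occurs twice, hence the factor 2. *)
Lemma sum_skew_sqr2 (R : realType) (M : 'I_2 -> 'I_2 -> R) :
  \sum_(ij : 'I_2 * 'I_2) (M ij.1 ij.2 - M ij.2 ij.1) ^+ 2 = 2 * (M 0 1 - M 1 0) ^+ 2.
Proof.
rewrite -(pair_bigA _ (fun i j => (M i j - M j i) ^+ 2))/= !big_ord_recl !big_ord0.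
have -> : lift ord0 ord0 = 1 :> 'I_2 by apply/val_inj.
rewrite (_ : ord0 = 0 :> 'I_2)//; ring.
Qed.

Lemma sum_skew_sqr3 (R : realType) (M : 'I_3 -> 'I_3 -> R) :
  \sum_(ij : 'I_3 * 'I_3) (M ij.1 ij.2 - M ij.2 ij.1) ^+ 2 =
  2 * ((M 1 2 - M 2 1) ^+ 2 + (M 2 0 - M 0 2) ^+ 2 + (M 0 1 - M 1 0) ^+ 2).
Proof.
rewrite -(pair_bigA _ (fun i j => (M i j - M j i) ^+ 2))/= !big_ord_recl !big_ord0.
have -> : lift ord0 (lift ord0 ord0) = 2 :> 'I_3 by apply/val_inj.
have -> : lift ord0 ord0 = 1 :> 'I_3 by apply/val_inj.
rewrite (_ : ord0 = 0 :> 'I_3)//; ring.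
Qed.

Lemma curl2_sqr (R : realType) (u : 'rV[R]_2 -> 'rV[R]_2) x :
  \sum_(ij : 'I_2 * 'I_2) (partial ij.1 (fun y => u y 0 ij.2) x -
    partial ij.2 (fun y => u y 0 ij.1) x) ^+ 2 = 2 * \sum_(i < 1) curl u x 0 i ^+ 2.
Proof.
rewrite (sum_skew_sqr2 (fun i j => partial i (fun y => u y 0 j) x)).
by rewrite big_ord1 mxE.
Qed.

Lemma curl3_sqr (R : realType) (u : 'rV[R]_3 -> 'rV[R]_3) x :
  \sum_(ij : 'I_3 * 'I_3) (partial ij.1 (fun y => u y 0 ij.2) x -
    partial ij.2 (fun y => u y 0 ij.1) x) ^+ 2 = 2 * \sum_(i < 3) curl u x 0 i ^+ 2.
Proof.
rewrite (sum_skew_sqr3 (fun i j => partial i (fun y => u y 0 j) x)).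
by rewrite !big_ord_recl big_ord0 !mxE/= addr0 addrA.
Qed.

Unset Implicit Arguments.
Set Strict Implicit.
Set Printing Implicit Defensive.

Theorem theorem1p1 (R : realType) (n : nat) (hn : n = 2%N \/ n = 3%N)
  (T alpha : R) (hT : 0 < T) (halpha : alpha <> -1)
  (v0 b0 : 'rV[R]_n -> 'rV[R]_n) (v b : 'rV[R]_n -> R -> 'rV[R]_n)
  (V B : 'rV[R]_n -> 'rV[R]_n)
  (hsol : classical_MHD_solution T v0 b0 v b)
  (hv : self_similar T alpha v V) (hb : self_similar T alpha b B)
  (hVB : C1_0 V /\ C1_0 B)
  (hLq : exists q1 : R, 0 < q1 /\ forall q : R, 0 < q < q1 ->
     Lebesgue_class q (curl V) /\ Lebesgue_class q B) :
  (forall x, V x = 0) /\ (forall x, B x = 0).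
Proof.
case: hVB => C1V C1B; case: hLq => q1 [q10 Hq].
(* The range of exponents is halved because the Liouville principle is applied to squared norms. *)
have q20 : 0 < q1 / 2 by rewrite divr_gt0.
have Hp p : 0 < p < q1 / 2 ->
    Lebesgue_class (2 * p) (curl V) /\ Lebesgue_class (2 * p) B.
  move=> /andP[p0 pq]; apply: Hq; rewrite mulr_gt0//=.
  by rewrite mulrC -ltr_pdivlMr.
have n0 : (0 < n)%N by case: hn => ->.
have B0 : forall x, B x = 0.
  apply: (magnetic_profile_eq0 n0 hT halpha q20 hsol hv hb C1V C1B) => p /Hp[_ Bp].
  by apply: (Lebesgue_class_sqr (c := 1)
    (s := fun x => \sum_i B x 0 i ^+ 2) _ _ Bp) => // x; rewrite mul1r.
split=> //.
apply: (velocity_profile_eq0 n0 hT halpha q20 hsol hv hb C1V C1B) => // p /Hp[Vp _].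
case: hn => nE; subst n.
- apply: (Lebesgue_class_sqr (c := 2) (s := fun x => \sum_(ij : 'I_2 * 'I_2)
    (partial ij.1 (fun y => V y 0 ij.2) x -
     partial ij.2 (fun y => V y 0 ij.1) x) ^+ 2) _ _ Vp) => //.
  exact: curl2_sqr.
- apply: (Lebesgue_class_sqr (c := 2) (s := fun x => \sum_(ij : 'I_3 * 'I_3)
    (partial ij.1 (fun y => V y 0 ij.2) x -
     partial ij.2 (fun y => V y 0 ij.1) x) ^+ 2) _ _ Vp) => //.
  exact: curl3_sqr.
Qed.
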